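(* Let $I_2=(x(y^2-z^2),\,y(z^2-x^2),\,z(x^2-y^2))\subset \mathbb{C}[x,y,z]$. Then the Waldschmidt constant of $I_2$ is $\widehat{\alpha}(I_2)=\frac{5}{2}$, and the resurgence number and asymptotic resurgence number of $I_2$ are $\rho(I_2)=\widehat{\rho}(I_2)=\frac{6}{5}$.
   Context: Let $R=\mathbb{C}[x,y,z]$ with the standard grading. For a nonzero homogeneous ideal $J\subseteq R$, $\alpha(J)$ denotes the least degree of a nonzero homogeneous polynomial in $J$. For a homogeneous ideal $I\subseteq R$ and an integer $m\ge 1$, the $m$-th symbolic power of $I$ is $I^{(m)}:=\bigcap_{\mathfrak{p}\in \mathrm{Ass}(R/I)} \left(I^mR_{\mathfrak{p}}\cap R\right)$. The Waldschmidt constant of $I$ is $\widehat{\alpha}(I):=\lim_{m\to\infty}\frac{\alpha(I^{(m)})}{m}$ (the limit exists and equals $\inf_{m\ge 1}\frac{\alpha(I^{(m)})}{m}$). The resurgence number of $I$ is $\rho(I):=\sup\{\frac{m}{r} : I^{(m)}\not\subseteq I^r\}$ and the asymptotic resurgence number of $I$ is $\widehat{\rho}(I):=\sup\{\frac{m}{r} : I^{(mt)}\not\subseteq I^{rt}\text{ for all } t\gg 0\}$, where $m,r$ range over positive integers. *)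

(* Defs.v *)
From mathcomp Require Import all_boot all_order all_algebra.
From mathcomp Require Import complex.
(* The notations of [mpoly] clash with those of mathcomp-analysis. *)
From mathcomp Require Import -(notations) mpoly.
From mathcomp Require Import all_classical all_reals all_analysis.

Set Implicit Arguments.
Unset Strict Implicit.
Unset Printing Implicit Defensive.

Import Order.TTheory GRing.Theory Num.Theory.
Import numFieldNormedType.Exports.

Local Open Scope classical_set_scope.
Local Open Scope ring_scope.

Section Ideals.
Variable A : idomainType.
Implicit Types (S I J p : set A).

Definition ideal_span S : set A :=
  [set f | exists k (c s : 'I_k -> A),
     (forall i, S (s i)) /\ f = \sum_(i < k) c i * s i].

(* For [m = 0] the only generator is the empty product, and the power is [A]. *)
Definition ideal_pow I m : set A :=
  ideal_span [set f | exists s : 'I_m -> A,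
     (forall i, I (s i)) /\ f = \prod_(i < m) s i].

(* [idealr_closed] requires [1 \notin p], so that prime ideals are proper. *)
Definition prime_ideal p : Prop :=
  idealr_closed (mem p) /\ prime_idealr_closed (mem p).

(* Ass(A/I): the primes that are the annihilator of the class of some [f]. *)
Definition associated_prime I p : Prop :=
  prime_ideal p /\ exists f, p = [set g | I (g * f)].

(* As [A] is a domain, A_p is realised inside the fraction field of [A]. *)
Definition localization p : set {fraction A} :=
  [set u | exists a s, ~ p s /\ u = tofrac a / tofrac s].

(* The ideal J A_p of A_p. *)
Definition ideal_extension p J : set {fraction A} :=
  [set u | exists k (c : 'I_k -> {fraction A}) (a : 'I_k -> A),
     [/\ forall i, localization p (c i), forall i, J (a i)
       & u = \sum_(i < k) c i * tofrac (a i)]].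

Definition symbolic_pow I m : set A :=
  [set f | forall p, associated_prime I p ->
     ideal_extension p (ideal_pow I m) (tofrac f)].

Variable R : realType.

Definition resurgence I : \bar R :=
  ereal_sup [set q | exists m r : nat,
    [/\ (0 < m)%N, (0 < r)%N, ~ (symbolic_pow I m `<=` ideal_pow I r)
      & q = (m%:R / r%:R)%:E]].

Definition asymptotic_resurgence I : \bar R :=
  ereal_sup [set q | exists m r : nat,
    [/\ (0 < m)%N, (0 < r)%N,
        \forall t \near \oo,
          ~ (symbolic_pow I (m * t)%N `<=` ideal_pow I (r * t)%N)
      & q = (m%:R / r%:R)%:E]].

End Ideals.

Section Waldschmidt.
Variables (n : nat) (K : idomainType).
Implicit Types I J : set (mpoly n K).

Definition has_form_of_degree J (d : nat) : Prop :=
  exists f, [/\ J f, f != 0 & f \is ishomog1 d mdeg].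

(* The default value 0 is only taken when [J] contains no nonzero form. *)
Definition alpha J : nat :=
  xget 0%N [set d | has_form_of_degree J d /\
                    forall e, has_form_of_degree J e -> (d <= e)%N].

Definition is_waldschmidt_constant (R : realType) I (a : R) : Prop :=
  (fun m : nat => (alpha (symbolic_pow I m))%:R / m%:R : R) @ \oo --> a.

End Waldschmidt.

Arguments resurgence {A} R I.
Arguments asymptotic_resurgence {A} R I.

Definition I2 (R : realType) : set (mpoly 3 R[i]) :=
  let var k : mpoly 3 R[i] := mpolyX _ (mnm1 (inord k)) in
  let x := var 0%N in let y := var 1%N in let z := var 2%N in
  ideal_span [set x * (y ^+ 2 - z ^+ 2);
                  y * (z ^+ 2 - x ^+ 2);
                  z * (x ^+ 2 - y ^+ 2)].
Arguments I2 : clear implicits.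

(* Main.v *)
(* Write [I] for the ideal, which is the ideal of the seven points (1 : 0 : 0),
   (0 : 1 : 0), (0 : 0 : 1) and (1 : +-1 : +-1), and [m] for (x, y, z).

   Every form [f] of degree [d] in [I^(m)] has [2 d >= 5 m]: through a general
   point of the plane passes a rational quartic with nodes at the first three
   points that contains the other four, and Bezout's bound 4 d >= 10 m follows if
   [f] does not vanish on it.  The form [P^2 Q], where [P] is the product of the
   six lines x = +-y, y = +-z, z = +-x and [Q = x y z], has degree 15 and lies in
   [I^(6)].  Hence the Waldschmidt constant is 5/2; as [I^r] starts in degree 3 r,
   [(P^2 Q)^k] is not in [I^(5k+1)], and both resurgences are at least 6/5.

   For the upper bound, [I^(m)] is contained in the saturation of [I^r] if
   [m >= r], and [I^r] is saturated in degrees > 3 r.  If 5 m > 6 r, then all forms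
   in [I^(m)] have degree > 3 r, so [I^(m)] is contained in [I^r].  The claim on
   the saturation is checked on the plane [l = x + y + z = 0], which avoids the
   seven points: there [I] is generated by [x h], [y h] and [n] with [h] a
   quadratic form prime to the cubic [n], and the relations between these
   generators lift modulo [l] to relations in [I]. *)
From HB Require Import structures.
Require Import Defs.
From mathcomp Require Import all_boot all_order all_algebra.
From mathcomp Require Import complex.
From mathcomp Require Import -(notations) mpoly.
From mathcomp Require Import all_classical all_reals all_analysis.
From mathcomp Require Import ring lra zify.

Set Implicit Arguments.
Unset Strict Implicit.
Unset Printing Implicit Defensive.

Import Order.TTheory GRing.Theory Num.Theory.

Local Open Scope classical_set_scope.
Local Open Scope ring_scope.

(** * Ideals *)

Section IdealTheory.
Variable A : idomainType.
Implicit Types (S I J : set A) (f g u : A).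

Definition is_ideal J : Prop :=
  [/\ J 0, forall f g, J f -> J g -> J (f + g) & forall u f, J f -> J (u * f)].

Lemma is_ideal0 J : is_ideal J -> J 0. Proof. by case. Qed.

Lemma is_idealD J f g : is_ideal J -> J f -> J g -> J (f + g).
Proof. by case=> _ + _; apply. Qed.

Lemma is_idealMl J u f : is_ideal J -> J f -> J (u * f).
Proof. by case=> _ _; apply. Qed.

Lemma is_idealMr J u f : is_ideal J -> J f -> J (f * u).
Proof. by rewrite mulrC; apply: is_idealMl. Qed.

Lemma is_idealN J f : is_ideal J -> J f -> J (- f).
Proof. by rewrite -mulN1r; apply: is_idealMl. Qed.

Lemma is_idealB J f g : is_ideal J -> J f -> J g -> J (f - g).
Proof. by move=> idJ Jf Jg; apply: is_idealD => //; apply: is_idealN. Qed.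

Lemma ideal_sum J (T : Type) (r : seq T) (P : pred T) (F : T -> A) :
  is_ideal J -> (forall i, P i -> J (F i)) -> J (\sum_(i <- r | P i) F i).
Proof.
by move=> idJ JF; elim/big_rec: _ => [|i f Pi Jf];
  [exact: is_ideal0 | apply: is_idealD => //; apply: JF].
Qed.

Lemma principal_ideal u : is_ideal [set f | exists q, f = u * q].
Proof.
split=> [|f g [p ->] [q ->]|v f [q ->]]; first by exists 0; rewrite mulr0.
  by exists (p + q); rewrite mulrDr.
by exists (v * q); rewrite mulrCA.
Qed.

Lemma ideal_span_ideal S : is_ideal (ideal_span S).
Proof.
split=> [|_ _ [k [c [s [Ss ->]]]] [l [d [t [St ->]]]]|u _ [k [c [s [Ss ->]]]]].
- by exists 0%N, (fun=> 0), (fun=> 0); split=> [[]//|]; rewrite big_ord0.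
- pose glue T (p : 'I_k -> T) (q : 'I_l -> T) i :=
    match fintype.split i with inl j => p j | inr j => q j end.
  exists (k + l)%N, (glue _ c d), (glue _ s t); split=> [i|].
    by rewrite /glue; case: fintype.split.
  rewrite big_split_ord /=; congr (_ + _); apply: eq_bigr => i _.
    by rewrite /glue (unsplitK (inl i)).
  by rewrite /glue (unsplitK (inr i)).
- exists k, (fun i => u * c i), s; split=> //.
  by rewrite mulr_sumr; apply: eq_bigr => i _; rewrite mulrA.
Qed.

Lemma mem_ideal_span S f : S f -> ideal_span S f.
Proof.
by move=> Sf; exists 1%N, (fun=> 1), (fun=> f); rewrite big_ord1 mul1r.
Qed.

Lemma ideal_span_min S J :
  is_ideal J -> S `<=` J -> ideal_span S `<=` J.
Proof.
move=> idJ SJ f [k [c [s [Ss ->]]]].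
by apply: ideal_sum => // i _; apply: is_idealMl => //; apply: SJ.
Qed.

Lemma ideal_pow_ideal I m : is_ideal (ideal_pow I m).
Proof. exact: ideal_span_ideal. Qed.

Lemma ideal_pow0 I f : ideal_pow I 0 f.
Proof.
rewrite -[f]mulr1; apply: is_idealMl; first exact: ideal_pow_ideal.
by apply: mem_ideal_span; exists (fun=> 0); split=> [[]//|]; rewrite big_ord0.
Qed.

Lemma ideal_powM I i j f g :
  ideal_pow I i f -> ideal_pow I j g -> ideal_pow I (i + j)%N (f * g).
Proof.
have idP := ideal_pow_ideal I (i + j).
move=> [k [c [s [Ss ->]]]] [l [d [t [St ->]]]].
rewrite mulr_suml; apply: ideal_sum => // p _.
rewrite mulr_sumr; apply: ideal_sum => // q _; rewrite mulrACA.
apply: is_idealMl => //; apply: mem_ideal_span.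
have [v [Iv ->]] := Ss p; have [w [Iw ->]] := St q.
exists (fun n => match fintype.split n with inl a => v a | inr b => w b end).
split=> [n|]; first by case: fintype.split.
rewrite big_split_ord /=; congr (_ * _); apply: eq_bigr => n _.
  by rewrite (unsplitK (inl n)).
by rewrite (unsplitK (inr n)).
Qed.

Lemma mem_ideal_pow1 I f : I f -> ideal_pow I 1 f.
Proof.
by move=> If; apply: mem_ideal_span; exists (fun=> f); rewrite big_ord1.
Qed.

Lemma ideal_powX I k m f : ideal_pow I k f -> ideal_pow I (k * m)%N (f ^+ m).
Proof.
move=> If; elim: m => [|m IHm]; first by rewrite muln0; apply: ideal_pow0.
by rewrite exprS mulnS; apply: ideal_powM.
Qed.

Lemma ideal_pow_min I J m : is_ideal J ->
  (forall s : 'I_m -> A, (forall i, I (s i)) -> J (\prod_(i < m) s i)) ->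
  ideal_pow I m `<=` J.
Proof. by move=> idJ IJ; apply: ideal_span_min => // _ [s [Is ->]]; apply: IJ. Qed.

Lemma ideal_pow_anti I m r : (r <= m)%N -> ideal_pow I m `<=` ideal_pow I r.
Proof.
move=> /subnK <-; rewrite addnC; apply: ideal_pow_min => [|s Is].
  exact: ideal_pow_ideal.
rewrite big_split_ord /=; apply: is_idealMr; first exact: ideal_pow_ideal.
by apply: mem_ideal_span; exists (fun i => s (lshift _ i)).
Qed.

Lemma ideal_pow1 I : is_ideal I -> ideal_pow I 1 `<=` I.
Proof. by move=> idI; apply: ideal_pow_min => // s Is; rewrite big_ord1. Qed.

(** Turns membership in a power of the ideal into divisibility by a power of [w], that is, into an
    order of vanishing. *)
Lemma ideal_pow_rmorph (B : idomainType) (phi : {rmorphism A -> B}) I w m f :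
  (forall g, I g -> exists q, phi g = w * q) ->
  ideal_pow I m f -> exists q, phi f = w ^+ m * q.
Proof.
move=> Iw; set J := [set g | exists q, phi g = w ^+ m * q].
suff : ideal_pow I m `<=` J by apply.
apply: ideal_pow_min => [|s Is].
  split=> [|g h [p gE] [q hE]|u g [p gE]]; first by exists 0; rewrite rmorph0 mulr0.
    by exists (p + q); rewrite rmorphD /= gE hE mulrDr.
  by exists (phi u * p); rewrite rmorphM /= gE mulrCA.
have [q sE] := choice (fun i => Iw _ (Is i)).
exists (\prod_i q i); rewrite rmorph_prod /= (eq_bigr _ (fun i _ => sE i)).
by rewrite big_split /= prodr_const card_ord.
Qed.

Lemma ideal_radicalD J f g :
  is_ideal J -> (exists N, J (f ^+ N)) -> (exists N, J (g ^+ N)) ->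
  exists N, J ((f + g) ^+ N).
Proof.
move=> idJ [m Jf] [n Jg]; exists (m + n)%N; rewrite exprDn.
apply: ideal_sum => // i _; rewrite -mulr_natl; apply: is_idealMl => //.
have [le_ni|lt_in] := leqP n i.
  by apply: is_idealMl => //; rewrite -(subnK le_ni) exprD; apply: is_idealMl.
apply: is_idealMr => //; have : (m <= m + n - i)%N by lia.
by move=> /subnK <-; rewrite exprD; apply: is_idealMl.
Qed.

Lemma ideal_radicalM J u f :
  is_ideal J -> (exists N, J (f ^+ N)) -> exists N, J ((u * f) ^+ N).
Proof. by move=> idJ [m Jf]; exists m; rewrite exprMn; apply: is_idealMl. Qed.

(* The list may contain associated or repeated primes. *)
Lemma prod_primes_dvd (cs : seq A) F :
  (forall c, c \in cs -> [/\ c != 0,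
     forall a b, (exists q, a * b = c * q) ->
        (exists q, a = c * q) \/ (exists q, b = c * q)
   & exists s, ~ (exists q, s = c * q) /\
               exists q, s * F = (\prod_(d <- cs) d) * q]) ->
  exists q, F = (\prod_(d <- cs) d) * q.
Proof.
elim: cs F => [|c cs IHcs] F csP; first by exists F; rewrite big_nil mul1r.
have [c0 c_pr [s [s_c [q sF]]]] := csP c (mem_head _ _).
(* A prime [c] dividing [s * F] but not [s] divides [F]; the other primes keep their own witnesses
   once [c] is cancelled. *)
have [//|[F' FE]] : (exists q, s = c * q) \/ (exists q, F = c * q).
  by apply: c_pr; rewrite sF big_cons -mulrA; eexists.
have [|q' F'E] := IHcs F'; last by exists q'; rewrite FE F'E big_cons mulrA.
move=> d cs_d; have [|d0 d_pr [t [t_d [p tF]]]] := csP d.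
  by rewrite inE cs_d orbT.
split=> //; exists t; split=> //; exists p; apply: (mulfI c0).
by rewrite mulrCA -FE tF big_cons mulrA.
Qed.

Lemma prime_pow_dvd (c s F : A) m : c != 0 ->
  (forall a b, (exists q, a * b = c * q) ->
     (exists q, a = c * q) \/ (exists q, b = c * q)) ->
  ~ (exists q, s = c * q) -> (exists q, s * F = c ^+ m * q) ->
  exists q, F = c ^+ m * q.
Proof.
move=> c0 c_pr s_c sF.
have cE : c ^+ m = \prod_(d <- nseq m c) d by rewrite big_nseq iter_mulr_1.
rewrite cE in sF *; apply: prod_primes_dvd => d; rewrite mem_nseq.
by case/andP=> _ /eqP->; split=> //; exists s.
Qed.

End IdealTheory.

Lemma polyX_dvd (B : idomainType) (h : {poly B}) :
  (exists q, h = 'X * q) <-> h`_0 = 0.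
Proof.
split=> [[q ->]|h0]; first by rewrite coefXM.
have /factor_theorem[q ->] : root h 0 by rewrite /root horner_coef0 h0.
by exists q; rewrite subr0 mulrC.
Qed.

(** * Homogeneous components and restrictions to lines *)

Definition vec3 T (a b c : T) (i : 'I_3) : T :=
  match nat_of_ord i with 0%N => a | 1%N => b | _ => c end.

HB.lock Definition msubst (C : fieldType) (S : comNzRingType)
    (iota : {rmorphism C -> S}) (a b c : S) : mpoly 3 C -> S :=
  mmap iota (vec3 a b c).

Section Substitution.
Variable C : fieldType.
Local Notation A := (mpoly 3 C).
Local Notation cst := (@mpolyC 3 C).

Definition mvar k : A := mpolyX C (mnm1 (inord k)).
Local Notation x := (mvar 0).
Local Notation y := (mvar 1).
Local Notation z := (mvar 2).

Lemma ord3_cases (i : 'I_3) : [\/ i = inord 0, i = inord 1 | i = inord 2].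
Proof.
have iE : i = inord i by rewrite inord_val.
by case: i iE => [[|[|[|?]]] ?] //= ->; [apply: Or31|apply: Or32|apply: Or33].
Qed.

Lemma mpoly3_ind (P : A -> Prop) :
  (forall c, P (cst c)) -> P x -> P y -> P z ->
  (forall f g, P f -> P g -> P (f + g)) ->
  (forall f g, P f -> P g -> P (f * g)) ->
  forall f, P f.
Proof.
move=> PC Px Py Pz PD PM; elim/mpolyind => [|c m f _ _ Pf].
  by rewrite -(mpolyC0 3 C).
apply: PD => //; rewrite -mul_mpolyC; apply: (PM) => //.
rewrite mpolyXE_id; apply: big_ind => [||i _]; first by rewrite -mpolyC1.
  exact: PM.
elim: (m i) => [|k IHk]; first by rewrite expr0 -mpolyC1.
by rewrite exprS; apply: PM => //; case: (ord3_cases i) => ->.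
Qed.

Lemma rmorph_ext3 (S : pzRingType) (h k : {rmorphism A -> S}) :
  (forall c, h (cst c) = k (cst c)) -> h x = k x -> h y = k y -> h z = k z ->
  h =1 k.
Proof.
move=> hkC hkx hky hkz; elim/mpoly3_ind => // f g hkf hkg.
  by rewrite !rmorphD hkf hkg.
by rewrite !rmorphM hkf hkg.
Qed.

Section Subst.
Variables (S : comNzRingType) (iota : {rmorphism C -> S}) (a b c : S).

Local Notation msubst := (msubst iota a b c).

Fact msubst_is_zmod_morphism : zmod_morphism msubst.
Proof. by rewrite unlock => f g; rewrite mmapB. Qed.
HB.instance Definition _ :=
  GRing.isZmodMorphism.Build A S msubst msubst_is_zmod_morphism.

Fact msubst_is_monoid_morphism : monoid_morphism msubst.
Proof. by rewrite unlock; split=> [|f g]; rewrite (rmorph1, rmorphM). Qed.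
HB.instance Definition _ :=
  GRing.isMonoidMorphism.Build A S msubst msubst_is_monoid_morphism.

Lemma msubstC d : msubst (cst d) = iota d.
Proof. by rewrite unlock mmapC. Qed.
Lemma msubst_var i : msubst (mpolyX C (mnm1 i)) = vec3 a b c i.
Proof. by rewrite unlock mmapX mmap1U. Qed.
Lemma msubst0 : msubst x = a. Proof. by rewrite msubst_var /vec3 inordK. Qed.
Lemma msubst1 : msubst y = b. Proof. by rewrite msubst_var /vec3 inordK. Qed.
Lemma msubst2 : msubst z = c. Proof. by rewrite msubst_var /vec3 inordK. Qed.
Definition msubst_xyz := (msubst0, msubst1, msubst2).

End Subst.

Lemma msubst_id f : msubst cst x y z f = f.
Proof.
by apply: (rmorph_ext3 (k := idfun)) => [c|||] /=; rewrite ?msubstC ?msubst_xyz.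
Qed.

(** With the identity as one substitution and a restriction as the other, an [f] whose restriction
    vanishes lies in every ideal that contains the equations. *)
Lemma msubst_congr (S : idomainType) (iota : {rmorphism C -> S})
    (a b c a' b' c' : S) (J : set S) f :
  is_ideal J -> J (a - a') -> J (b - b') -> J (c - c') ->
  J (msubst iota a b c f - msubst iota a' b' c' f).
Proof.
move=> idJ Ja Jb Jc; elim/mpoly3_ind: f => [d||||f g Jf Jg|f g Jf Jg].
- by rewrite !msubstC subrr; apply: is_ideal0.
- by rewrite !msubst_xyz.
- by rewrite !msubst_xyz.
- by rewrite !msubst_xyz.
- by rewrite !rmorphD opprD addrACA; apply: is_idealD.
- rewrite !rmorphM /=; set u := msubst _ _ _ _ f; set u' := msubst _ _ _ _ f.
  set v := msubst _ _ _ _ g; set v' := msubst _ _ _ _ g.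
  have -> : u * v - u' * v' = u * (v - v') + v' * (u - u') by ring.
  by apply: is_idealD => //; apply: is_idealMl.
Qed.

(** A multiplicative filtration containing the coefficients of the substituted polynomials contains
    those of all values. It is applied to degrees, to homogeneity and to powers of the ideal. *)
Lemma msubst_filtration (B : comNzRingType) (iota : {rmorphism C -> B})
    (N : nat -> set B) (a b c : {poly B}) :
  (forall j, N j 0) ->
  (forall j f g, N j f -> N j g -> N j (f + g)) ->
  (forall d, N 0%N (iota d)) ->
  (forall i j f g, N i f -> N j g -> N (i + j)%N (f * g)) ->
  (forall j, N j a`_j) -> (forall j, N j b`_j) -> (forall j, N j c`_j) ->
  forall f j, N j (msubst (polyC \o iota) a b c f)`_j.
Proof.
move=> N0 ND NC NM Na Nb Nc; elim/mpoly3_ind => [d||||f g Nf Ng|f g Nf Ng] j.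
- by rewrite msubstC /= coefC; case: eqP => [->|].
- by rewrite msubst_xyz.
- by rewrite msubst_xyz.
- by rewrite msubst_xyz.
- by rewrite rmorphD coefD; apply: ND.
- rewrite rmorphM coefM; elim/big_ind: _ => // [f' g'|i _]; first exact: ND.
  by rewrite -{1}(subnKC (ltn_ord i : (i <= j)%N)); apply: NM.
Qed.

(* [Phi f] is [f(t x, t y, t z)]; its coefficient in [t ^ d] is the component of
   degree [d] of [f]. *)
Definition Phi : A -> {poly A} :=
  msubst (polyC \o cst) (x%:P * 'X) (y%:P * 'X) (z%:P * 'X).

HB.instance Definition _ := GRing.RMorphism.on Phi.

Lemma PhiC d : Phi (cst d) = (cst d)%:P. Proof. exact: msubstC. Qed.
Lemma Phi_x : Phi x = x%:P * 'X. Proof. exact: msubst0. Qed.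
Lemma Phi_y : Phi y = y%:P * 'X. Proof. exact: msubst1. Qed.
Lemma Phi_z : Phi z = z%:P * 'X. Proof. exact: msubst2. Qed.
Definition Phi_xyz := (Phi_x, Phi_y, Phi_z).

Lemma coef_CX (B : nzRingType) (a : B) j :
  (a%:P * 'X)`_j = if j == 1%N then a else 0.
Proof. by rewrite coefCM coefX; case: eqP; rewrite ?mulr1 ?mulr0. Qed.

Lemma Phi_filtration (N : nat -> set A) :
  (forall j, N j 0) ->
  (forall j f g, N j f -> N j g -> N j (f + g)) ->
  (forall d, N 0%N (cst d)) ->
  (forall i j f g, N i f -> N j g -> N (i + j)%N (f * g)) ->
  N 1%N x -> N 1%N y -> N 1%N z ->
  forall f j, N j (Phi f)`_j.
Proof.
move=> N0 ND NC NM Nx Ny Nz.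
by apply: msubst_filtration => // j; rewrite coef_CX; case: eqP => [->|].
Qed.

(** * Forms and the order at the origin *)

Definition is_form d f : Prop := Phi f = f%:P * 'X^d.

Lemma is_formM i j f g : is_form i f -> is_form j g -> is_form (i + j)%N (f * g).
Proof.
by rewrite /is_form rmorphM /= => -> ->; rewrite mulrACA -exprD -polyCM.
Qed.

Lemma is_formD d f g : is_form d f -> is_form d g -> is_form d (f + g).
Proof. by rewrite /is_form rmorphD /= => -> ->; rewrite -mulrDl -polyCD. Qed.

Lemma is_formN d f : is_form d f -> is_form d (- f).
Proof. by rewrite /is_form rmorphN /= => ->; rewrite -mulNr -polyCN. Qed.

Lemma is_formB d f g : is_form d f -> is_form d g -> is_form d (f - g).
Proof. by move=> df dg; exact: is_formD df (is_formN dg). Qed.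

Lemma is_formX d k f : is_form d f -> is_form (d * k)%N (f ^+ k).
Proof.
move=> df; elim: k => [|k IHk].
  by rewrite muln0 /is_form expr0 rmorph1 mulr1.
by rewrite exprS mulnS; apply: is_formM.
Qed.

Lemma is_form_x : is_form 1 x. Proof. exact: Phi_x. Qed.
Lemma is_form_y : is_form 1 y. Proof. exact: Phi_y. Qed.
Lemma is_form_z : is_form 1 z. Proof. exact: Phi_z. Qed.

Lemma is_form_Phi d f : is_form d (Phi f)`_d.
Proof.
apply: (@Phi_filtration is_form) => [j|j g h|c|i j g h|||].
- by rewrite /is_form rmorph0 polyC0 mul0r.
- exact: is_formD.
- by rewrite /is_form PhiC mulr1.
- exact: is_formM.
- exact: is_form_x.
- exact: is_form_y.
- exact: is_form_z.
Qed.

Lemma coef_Phi_form d e f : is_form d f -> (Phi f)`_e = if e == d then f else 0.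
Proof. by move=> ->; rewrite coefCM coefXn; case: eqP; rewrite ?mulr1 ?mulr0. Qed.

Lemma coef_PhiM d e f g : is_form d f -> (Phi (f * g))`_(e + d) = f * (Phi g)`_e.
Proof.
move=> df; rewrite rmorphM /= df mulrAC coefMXn coefCM.
by rewrite ltnNge leq_addl addnK.
Qed.

Lemma Phi_horner1 f : (Phi f).[1] = f.
Proof.
apply: (rmorph_ext3 (h := horner_eval 1 \o Phi) (k := idfun)) => [c|||] /=;
  by rewrite /horner_eval ?Phi_xyz ?PhiC ?hornerE.
Qed.

Lemma sum_Phi f : f = \sum_(d < size (Phi f)) (Phi f)`_d.
Proof.
rewrite -{1}[f]Phi_horner1 horner_coef.
by apply: eq_bigr => d _; rewrite expr1n mulr1.
Qed.

(** This is the [k]-th power of the ideal [(x, y, z)], described by components. *)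
Definition order_ge k : set A := [set f | forall d, (d < k)%N -> (Phi f)`_d = 0].

Lemma order_ge_ideal k : is_ideal (order_ge k).
Proof.
split=> [d _|f g f_k g_k d lt_dk|u f f_k d lt_dk].
- by rewrite rmorph0 coef0.
- by rewrite rmorphD coefD f_k // g_k // addr0.
- rewrite rmorphM coefM big1 // => i _; rewrite f_k ?mulr0 //.
  exact: leq_ltn_trans (leq_subr _ _) lt_dk.
Qed.

Lemma order_geM i j f g :
  order_ge i f -> order_ge j g -> order_ge (i + j)%N (f * g).
Proof.
move=> f_i g_j d lt_dij; rewrite rmorphM coefM big1 // => k _.
have [lt_ki|le_ik] := ltnP k i; first by rewrite f_i // mul0r.
rewrite g_j ?mulr0 //; move: (ltn_ord k); lia.
Qed.

Lemma order_ge_le k l f : (k <= l)%N -> order_ge l f -> order_ge k f.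
Proof. by move=> le_kl f_l d lt_dk; apply/f_l/(leq_trans lt_dk). Qed.

Lemma order_ge_form d f : is_form d f -> order_ge d f.
Proof. by move=> df e; rewrite (coef_Phi_form _ df); case: ltngtP. Qed.

Lemma order_ge0 f : order_ge 0 f. Proof. by []. Qed.

Definition low k f : A := \sum_(d < k) (Phi f)`_d.

Lemma Phi_low k f d : (Phi (low k f))`_d = if (d < k)%N then (Phi f)`_d else 0.
Proof.
rewrite /low rmorph_sum coef_sum.
rewrite (eq_bigr (fun i : 'I_k => if (i : nat) == d then (Phi f)`_d else 0)).
  rewrite -big_mkcond /=; case: ifP => [lt_dk|/negbT].
    by rewrite (big_pred1 (Ordinal lt_dk)) // => i; rewrite -val_eqE.
  rewrite -leqNgt => le_kd; rewrite big_pred0 // => i.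
  by apply/eqP=> iE; move: (ltn_ord i); rewrite iE ltnNge le_kd.
move=> i _ /=; rewrite (coef_Phi_form _ (is_form_Phi _ _)) eq_sym.
by case: eqP => [->|].
Qed.

Lemma order_ge_high k f : order_ge k (f - low k f).
Proof. by move=> d lt_dk; rewrite rmorphB coefB Phi_low lt_dk subrr. Qed.

Lemma low_order_ge k f : order_ge k f -> low k f = 0.
Proof. by move=> f_k; rewrite /low big1 // => i _; apply: f_k. Qed.

Lemma lowD k f g : low k (f + g) = low k f + low k g.
Proof.
by rewrite /low -big_split; apply: eq_bigr => d _; rewrite rmorphD coefD.
Qed.

Lemma low_formM d k f g : is_form d f -> low (k + d)%N (f * g) = f * low k g.
Proof.
move=> df; rewrite /low addnC big_split_ord /= big1 ?add0r => [|i _].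
  by rewrite mulr_sumr; apply: eq_bigr => i _; rewrite addnC (coef_PhiM _ _ df).
by apply: (order_geM (order_ge_form df) (@order_ge0 g)); rewrite addn0.
Qed.

Lemma mem_order_ge (N : set A) k f : is_ideal N ->
  order_ge k f -> (forall d, (k <= d)%N -> N (Phi f)`_d) -> N f.
Proof.
move=> idN f_k Nf; rewrite [f]sum_Phi; apply: ideal_sum => // i _.
have [lt_ik|/Nf//] := ltnP i k.
by rewrite f_k //; apply: is_ideal0.
Qed.

(* [tau a b c f] is the restriction of [f] to the line through the origin and
   [(a, b, c)]. *)
Definition tau (a b c : C) : A -> {poly C} :=
  msubst polyC (a%:P * 'X) (b%:P * 'X) (c%:P * 'X).

HB.instance Definition _ a b c := GRing.RMorphism.on (tau a b c).

Definition tau_xyz a b c :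
  (tau a b c x = a%:P * 'X) * (tau a b c y = b%:P * 'X) * (tau a b c z = c%:P * 'X).
Proof. by rewrite /tau !msubst_xyz. Qed.

Lemma tauC a b c d : tau a b c (cst d) = d%:P.
Proof. exact: msubstC. Qed.

Lemma horner_tau a b c (L : A) f :
  (map_poly cst (tau a b c f)).[L] =
    msubst cst (cst a * L) (cst b * L) (cst c * L) f.
Proof.
apply: (rmorph_ext3 (h := horner_eval L \o map_poly cst \o tau a b c))
  => [d|||]; rewrite /= /horner_eval ?tauC ?tau_xyz ?msubst_xyz ?msubstC;
  by rewrite ?rmorphM /= ?map_polyX ?map_polyC /= ?hornerE.
Qed.

Lemma tau_horner a b c (L : A) F :
  tau a b c L = 'X -> tau a b c (map_poly cst F).[L] = F.
Proof.
move=> LX; rewrite -horner_map /= -map_poly_comp LX.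
rewrite -[RHS]comp_polyXr /comp_poly; congr _.[_].
by apply: eq_map_poly => d /=; rewrite tauC.
Qed.

End Substitution.

(** * Symbolic powers *)

Section SymbolicPower.
Variable A : idomainType.
Implicit Types (I J p : set A) (f s t : A).

Lemma prime_idealP p : prime_ideal p ->
  [/\ is_ideal p, ~ p 1 & forall s t, p (s * t) -> p s \/ p t].
Proof.
case=> -[/set_mem p0 p1 pD] pr; split.
- split=> // [f g pf pg|u f pf].
    by have /set_mem := pD 1 f g (mem_set pf) (mem_set pg); rewrite mul1r.
  by have /set_mem := pD u f 0 (mem_set pf) (mem_set p0); rewrite addr0.
- by move=> p1'; move: p1; rewrite mem_set.
- by move=> s t /mem_set/pr/orP[] /set_mem; [left|right].
Qed.

Lemma tofrac_neq0 p s : prime_ideal p -> ~ p s -> tofrac s != 0.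
Proof.
move=> /prime_idealP[idp _ _] ps; rewrite tofrac_eq0.
by apply/eqP => s0; apply: ps; rewrite s0; apply: is_ideal0.
Qed.

(** The finitely many fractions in a member of the extended ideal have a common denominator outside
    [p]; clearing it removes the localization. *)
Lemma symbolic_powP I m f :
  symbolic_pow I m f <->
  forall p, associated_prime I p -> exists s, ~ p s /\ ideal_pow I m (s * f).
Proof.
have idP := ideal_pow_ideal I m.
split=> fP p assp; have [pr _] := assp; have [idp p1 pM] := prime_idealP pr.
- have [k [c [a [cP aP fE]]]] := fP p assp.
  suff [s [g [ps gP E]]] : exists s g, [/\ ~ p s, ideal_pow I m g &
      \sum_(i < k) c i * tofrac (a i) = tofrac g / tofrac s].
    exists s; split=> //; suff -> : s * f = g by [].
    by apply/eqP; rewrite -tofrac_eq tofracM fE E mulrC mulfVK // (tofrac_neq0 pr).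
  elim/big_ind: _ => [|u v [s [g [ps gP ->]]] [t [h [pt hP ->]]]|i _].
  + by exists 1, 0; rewrite tofrac0 mul0r; split=> //; apply: is_ideal0.
  + exists (s * t), (g * t + h * s); split; first by case/pM.
      by apply: is_idealD => //; apply: is_idealMr.
    rewrite tofracD !tofracM addf_div ?(tofrac_neq0 pr) //.
  + have [b [s [ps ->]]] := cP i; exists s, (b * a i); split=> //.
      exact: is_idealMl.
    by rewrite tofracM mulrAC.
- have [s [ps sfP]] := fP p assp.
  exists 1%N, (fun=> tofrac 1 / tofrac s), (fun=> s * f); split=> // [_|].
    by exists 1, s.
  rewrite big_ord1 tofrac1 mul1r tofracM mulrA mulVf ?mul1r //.
  exact: tofrac_neq0 pr ps.
Qed.

Lemma symbolic_pow_anti I m r : (r <= m)%N ->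
  symbolic_pow I m `<=` symbolic_pow I r.
Proof.
move=> le_rm f /symbolic_powP fP; apply/symbolic_powP => p /fP[s [ps sf]].
by exists s; split=> //; apply: ideal_pow_anti sf.
Qed.

Lemma symbolic_powX I m f k :
  symbolic_pow I m f -> symbolic_pow I (m * k)%N (f ^+ k).
Proof.
move=> /symbolic_powP fP; apply/symbolic_powP => p assp.
have [s [ps sf]] := fP p assp; have [pr _] := assp.
have [idp p1 pM] := prime_idealP pr.
exists (s ^+ k); split; last by rewrite -exprMn; apply: ideal_powX.
by elim: k => [|k IHk]; rewrite ?expr0 // exprS => /pM[].
Qed.

End SymbolicPower.

(** * The seven points *)

Section SevenPoints.
Variable C : numClosedFieldType.
Local Notation A := (mpoly 3 C).
Local Notation cst := (@mpolyC 3 C).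
Local Notation x := (mvar C 0).
Local Notation y := (mvar C 1).
Local Notation z := (mvar C 2).
Local Notation a := (x * (y ^+ 2 - z ^+ 2)).
Local Notation b := (y * (z ^+ 2 - x ^+ 2)).
Local Notation c := (z * (x ^+ 2 - y ^+ 2)).

Definition I7 : set A := ideal_span [set a; b; c].

Lemma I7_ideal : is_ideal I7. Proof. exact: ideal_span_ideal. Qed.
Lemma I7a : I7 a. Proof. by apply: mem_ideal_span; left; left. Qed.
Lemma I7b : I7 b. Proof. by apply: mem_ideal_span; left; right. Qed.
Lemma I7c : I7 c. Proof. by apply: mem_ideal_span; right. Qed.

Lemma I7_min (J : set A) : is_ideal J -> J a -> J b -> J c -> I7 `<=` J.
Proof. by move=> idJ Ja Jb Jc; apply: ideal_span_min => // _ [[]|] ->. Qed.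

Lemma I7_comb p q r f : f = p * a + q * b + r * c -> I7 f.
Proof.
have idI := I7_ideal.
move=> ->; apply: is_idealD => //; first apply: is_idealD => //.
- exact: is_idealMl I7a.
- exact: is_idealMl I7b.
- exact: is_idealMl I7c.
Qed.

Lemma I7_rmorph (B : comNzRingType) (phi : {rmorphism A -> B}) w f :
  (exists q, phi a = w * q) -> (exists q, phi b = w * q) ->
  (exists q, phi c = w * q) -> I7 f -> exists q, phi f = w * q.
Proof.
move=> wa wb wc; set J := [set g | exists q, phi g = w * q].
suff : I7 `<=` J by apply.
apply: I7_min => //; split=> [|g h [p gE] [q hE]|u g [p gE]].
- by exists 0; rewrite rmorph0 mulr0.
- by exists (p + q); rewrite rmorphD /= gE hE mulrDr.
- by exists (phi u * p); rewrite rmorphM /= gE mulrCA.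
Qed.

(** * The primes of the seven points *)

Implicit Types (p q r : C) (u L f g s : A).

(** The zero vector is included; [base_point_separates] excludes it. *)
Definition base_point p q r : Prop :=
  [/\ p * (q ^+ 2 - r ^+ 2) = 0, q * (r ^+ 2 - p ^+ 2) = 0
    & r * (p ^+ 2 - q ^+ 2) = 0].

Lemma tau_I7 p q r f : base_point p q r -> I7 f -> tau p q r f = 0.
Proof.
move=> [pa pb pc] If.
have [||||s ->] := @I7_rmorph _ (tau p q r) 0 f; rewrite ?mul0r //;
  exists 0; rewrite mul0r rmorphM rmorphB !rmorphXn /= !tau_xyz.
- by rewrite -[RHS](mul0r ('X ^+ 3)) -polyC0 -pa; ring.
- by rewrite -[RHS](mul0r ('X ^+ 3)) -polyC0 -pb; ring.
- by rewrite -[RHS](mul0r ('X ^+ 3)) -polyC0 -pc; ring.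
Qed.

(* [L] is a linear form taking the value 1 at the point, and [u] multiplies the
   ideal of the point into [I7] without vanishing at the point. *)
Definition separates p q r u L : Prop :=
  [/\ tau p q r u != 0, tau p q r L = 'X,
      I7 (u * (x - cst p * L)), I7 (u * (y - cst q * L))
    & I7 (u * (z - cst r * L))].

Lemma separates_associated p q r u L :
  base_point p q r -> separates p q r u L ->
  associated_prime I7 [set g | tau p q r g = 0].
Proof.
move=> bp [u_n0 LX Ix Iy Iz]; split.
  split; first split.
  - by apply: mem_set; rewrite /= rmorph0.
  - by apply/negP => /set_mem/eqP; rewrite /= rmorph1 oner_eq0.
  - move=> s f g /set_mem /= fP /set_mem /= gP; apply: mem_set => /=.
    by rewrite rmorphD rmorphM /= fP gP mulr0 addr0.
  move=> f g /set_mem /= /eqP; rewrite rmorphM mulf_eq0.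
  by case/orP=> /eqP ?; apply/orP; [left|right]; apply: mem_set.
(* The prime is the annihilator of [u] modulo [I7]. If [g u] is in [I7], then [g] vanishes on the
   line because [u] does not. Conversely, modulo [(I7 : u)] the variables are congruent to their
   projections to the line, where [g] vanishes. *)
exists u; apply/seteqP; split=> g /= gP; last first.
  have /eqP := tau_I7 bp gP; rewrite rmorphM mulf_eq0 (negPf u_n0) orbF.
  by move/eqP.
pose J := [set h | I7 (u * h)].
have idJ : is_ideal J.
  have idI := I7_ideal; split=> [|f h /=|s f].
  - by rewrite /J /= mulr0; apply: is_ideal0.
  - by rewrite /J /= mulrDr; apply: is_idealD.
  - by rewrite /J /= mulrCA; apply: is_idealMl.
have Jg := @msubst_congr _ _ cst x y z (cst p * L) (cst q * L) (cst r * L) J g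
  idJ Ix Iy Iz.
rewrite mulrC; suff -> : g = msubst cst x y z g -
    msubst cst (cst p * L) (cst q * L) (cst r * L) g by [].
rewrite msubst_id.
rewrite -horner_tau.
by rewrite gP map_poly0 horner0 subr0.
Qed.

Lemma symbolic_separated p q r u L m f :
  base_point p q r -> separates p q r u L -> symbolic_pow I7 m f ->
  exists s, tau p q r s != 0 /\ ideal_pow I7 m (s * f).
Proof.
move=> bp sep /symbolic_powP/(_ _ (separates_associated bp sep)).
by move=> [s [/eqP s_n0 sf]]; exists s.
Qed.

(** Deforms the projection to the line of the point, at ['X = 0], into the identity, at ['X = 1]. *)
Definition Psi p q r L : A -> {poly A} :=
  msubst (polyC \o cst)
    ((cst p * L)%:P + (x - cst p * L)%:P * 'X)
    ((cst q * L)%:P + (y - cst q * L)%:P * 'X)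
    ((cst r * L)%:P + (z - cst r * L)%:P * 'X).

HB.instance Definition _ p q r L := GRing.RMorphism.on (Psi p q r L).

Lemma Psi_xyz p q r L :
  (Psi p q r L x = (cst p * L)%:P + (x - cst p * L)%:P * 'X) *
  (Psi p q r L y = (cst q * L)%:P + (y - cst q * L)%:P * 'X) *
  (Psi p q r L z = (cst r * L)%:P + (z - cst r * L)%:P * 'X).
Proof. by rewrite /Psi !msubst_xyz. Qed.

(** Each factor ['X] carries a coefficient such as [x - cst p * L], which [u] multiplies into
    [I7]. *)
Lemma Psi_filtration p q r u L f j : separates p q r u L ->
  ideal_pow I7 j (u ^+ j * (Psi p q r L f)`_j).
Proof.
move=> [_ _ Ix Iy Iz].
have coefE s t k : (s%:P + t%:P * 'X)`_k =
    if k == 0%N then s else if k == 1%N then t else 0.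
  by rewrite coefD coefC coef_CX; case: k => [|[|k]]; rewrite /= ?addr0 ?add0r.
have P0 k : ideal_pow I7 k 0 by exact: is_ideal0 (ideal_pow_ideal _ _).
have lin s t k : I7 (u * t) ->
    ideal_pow I7 k (u ^+ k * (s%:P + t%:P * 'X)`_k).
  move=> It; rewrite coefE; case: k => [|[|k]] /=; rewrite ?mulr0 //.
    exact: ideal_pow0.
  exact: mem_ideal_pow1.
apply: (msubst_filtration (N := fun k => [set g | ideal_pow I7 k (u ^+ k * g)]))
  => [k|k g h|d|k l g h Pg Ph|k|k|k] /=; try exact: lin.
- by rewrite mulr0.
- by move=> ? ?; rewrite mulrDr; exact: (is_idealD (ideal_pow_ideal _ _)).
- exact: ideal_pow0.
- by rewrite exprD mulrACA; apply: ideal_powM.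
Qed.

(* The order of vanishing of [f] along the line of the point is read off
   [Psi f], whose coefficients are controlled by [Psi_filtration]. *)
Lemma symbolic_separator_pow p q r u L m f :
  base_point p q r -> separates p q r u L -> symbolic_pow I7 m f ->
  exists N, ideal_pow I7 m (u ^+ N * f).
Proof.
move=> bp sep /(symbolic_separated bp sep)[s [s_n0 sf]].
have [_ LX _ _ _] := sep.
pose psi := Psi p q r L.
have psi0 g : (psi g)`_0 = (map_poly cst (tau p q r g)).[L].
  rewrite horner_tau -horner_coef0.
  apply: (rmorph_ext3 (h := horner_eval 0 \o psi)) => [d|||] /=;
    by rewrite /horner_eval ?msubst_xyz ?Psi_xyz /psi /Psi ?msubstC ?hornerE
      ?mulr0 ?addr0.
(* As [psi] maps [I7] into [('X)], ['X^m] divides [psi (s * f)]; the prime ['X] does not divide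
   [psi s], since [s] is nonzero on the line. *)
have [G fG] : exists G, psi f = 'X^m * G.
  apply: (@prime_pow_dvd _ 'X (psi s)); first by rewrite polyX_eq0.
  - move=> g h /polyX_dvd/eqP; rewrite coef0M mulf_eq0.
    by case/orP=> /eqP ?; [left|right]; apply/polyX_dvd.
  - move/polyX_dvd; rewrite psi0 => s0; move: s_n0.
    by rewrite -(tau_horner (tau p q r s) LX) s0 rmorph0 eqxx.
  rewrite -rmorphM; apply: ideal_pow_rmorph sf => g Ig.
  by apply/polyX_dvd; rewrite psi0 (tau_I7 bp Ig) map_poly0 horner0.
have low0 k : (k < m)%N -> (psi f)`_k = 0 by move=> lt_km; rewrite fG coefXnM lt_km.
have idP := ideal_pow_ideal I7 m.
have fE : f = (psi f).[1].
  apply: (rmorph_ext3 (h := idfun) (k := horner_eval 1 \o psi)) => [d|||] /=;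
    rewrite /horner_eval ?Psi_xyz /psi /Psi ?msubstC ?hornerE //=; ring.
(* At ['X = 1], [f] is the sum of the coefficients of index [j >= m], and [u^j] multiplies the
   [j]-th one into [I7^j]; the size bounds all these exponents. *)
exists (size (psi f)); rewrite {2}fE horner_coef mulr_sumr.
apply: ideal_sum => // -[j lt_j] _; rewrite expr1n mulr1 /=.
have [lt_jm|le_mj] := ltnP j m.
  by rewrite low0 // mulr0; apply: is_ideal0.
rewrite -(subnK (ltnW lt_j)) exprD -mulrA; apply: is_idealMl => //.
exact/(ideal_pow_anti le_mj)/Psi_filtration/sep.
Qed.

(** The three lines with product [u] contain the six other points: [q x + p y = 0] passes through
    [(0 : 0 : 1)], [(-p : q : r)] and [(p : -q : r)], and similarly for the other two. *)
Lemma diagonal_separates p q r : p != 0 -> p ^+ 2 = q ^+ 2 -> p ^+ 2 = r ^+ 2 ->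
  separates p q r
    ((cst q * x + cst p * y) * (cst r * y + cst q * z) * (cst r * x + cst p * z))
    (cst p^-1 * x).
Proof.
move=> p0 pq pr.
have sq0 (s : C) : p ^+ 2 = s ^+ 2 -> s != 0.
  by move=> ps; rewrite -sqrf_eq0 -ps sqrf_eq0.
have [q0 r0] := (sq0 q pq, sq0 r pr).
have cp : cst p * cst p^-1 = 1 by rewrite -mpolyCM mulfV // mpolyC1.
have pq' : cst p ^+ 2 = cst q ^+ 2 by rewrite -!rmorphXn /= pq.
have pr' : cst p ^+ 2 = cst r ^+ 2 by rewrite -!rmorphXn /= pr.
split.
- rewrite !(rmorphM, rmorphD) /= !tauC !tau_xyz.
  have -> : (q%:P * (p%:P * 'X) + p%:P * (q%:P * 'X)) *
     (r%:P * (q%:P * 'X) + q%:P * (r%:P * 'X)) *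
     (r%:P * (p%:P * 'X) + p%:P * (r%:P * 'X)) =
     (8 * p ^+ 2 * q ^+ 2 * r ^+ 2)%:P * 'X ^+ 3 by ring.
  by rewrite mulf_neq0 ?expf_neq0 ?polyX_eq0 // polyC_eq0 !mulf_neq0
    ?expf_neq0 // pnatr_eq0.
- by rewrite rmorphM /= tauC tau_xyz mulrA -polyCM mulVf // mul1r.
- rewrite mulrA cp mul1r subrr mulr0; exact: is_ideal0 I7_ideal.
- rewrite (_ : y - _ = cst p^-1 * (cst p * y - cst q * x)); last first.
    by rewrite -{1}[y]mul1r -cp; ring.
  rewrite (_ : _ * _ = cst p^-1 * (cst p ^+ 2 * y ^+ 2 - cst q ^+ 2 * x ^+ 2) *
    (cst r * y + cst q * z) * (cst r * x + cst p * z)); last by ring.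
  rewrite -pq'; apply: (@I7_comb (cst p^-1 * cst p ^+ 2 * cst r ^+ 2 * y)
    (cst p^-1 * cst p ^+ 2 * cst r ^+ 2 * x)
    (- cst p^-1 * cst p ^+ 2 *
       (cst r * cst p * y + cst q * cst r * x + cst q * cst p * z))); ring.
- rewrite (_ : z - _ = cst p^-1 * (cst p * z - cst r * x)); last first.
    by rewrite -{1}[z]mul1r -cp; ring.
  rewrite (_ : _ * _ = cst p^-1 * (cst p ^+ 2 * z ^+ 2 - cst r ^+ 2 * x ^+ 2) *
    (cst q * x + cst p * y) * (cst r * y + cst q * z)); last by ring.
  rewrite -pr'; apply: (@I7_comb (- cst p^-1 * cst p ^+ 2 * cst q ^+ 2 * z)
    (cst p^-1 * cst p ^+ 2 *
       (cst q * cst r * x + cst p * cst r * y + cst p * cst q * z))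
    (- cst p^-1 * cst p ^+ 2 * cst q ^+ 2 * x)); ring.
Qed.

(** The four lines [z = +-x] and [x = +-y] contain the six other points. *)
Lemma x_separates p : p != 0 ->
  separates p 0 0 ((z ^+ 2 - x ^+ 2) * (x ^+ 2 - y ^+ 2)) (cst p^-1 * x).
Proof.
move=> p0; have cp : cst p * cst p^-1 = 1 by rewrite -mpolyCM mulfV // mpolyC1.
split.
- rewrite !(rmorphM, rmorphB, rmorphXn) /= !tau_xyz.
  rewrite (_ : _ * _ = (- p ^+ 4)%:P * 'X ^+ 4); last by ring.
  by rewrite mulf_neq0 ?expf_neq0 ?polyX_eq0 // polyC_eq0 oppr_eq0 expf_neq0.
- by rewrite rmorphM /= tauC tau_xyz mulrA -polyCM mulVf // mul1r.
- rewrite mulrA cp mul1r subrr mulr0; exact: is_ideal0 I7_ideal.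
- by rewrite mpolyC0; apply: (@I7_comb 0 (x ^+ 2 - y ^+ 2) 0); ring.
- by rewrite mpolyC0; apply: (@I7_comb 0 0 (z ^+ 2 - x ^+ 2)); ring.
Qed.

Lemma y_separates p : p != 0 ->
  separates 0 p 0 ((x ^+ 2 - y ^+ 2) * (y ^+ 2 - z ^+ 2)) (cst p^-1 * y).
Proof.
move=> p0; have cp : cst p * cst p^-1 = 1 by rewrite -mpolyCM mulfV // mpolyC1.
split.
- rewrite !(rmorphM, rmorphB, rmorphXn) /= !tau_xyz.
  rewrite (_ : _ * _ = (- p ^+ 4)%:P * 'X ^+ 4); last by ring.
  by rewrite mulf_neq0 ?expf_neq0 ?polyX_eq0 // polyC_eq0 oppr_eq0 expf_neq0.
- by rewrite rmorphM /= tauC tau_xyz mulrA -polyCM mulVf // mul1r.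
- by rewrite mpolyC0; apply: (@I7_comb (x ^+ 2 - y ^+ 2) 0 0); ring.
- rewrite mulrA cp mul1r subrr mulr0; exact: is_ideal0 I7_ideal.
- by rewrite mpolyC0; apply: (@I7_comb 0 0 (y ^+ 2 - z ^+ 2)); ring.
Qed.

Lemma z_separates p : p != 0 ->
  separates 0 0 p ((y ^+ 2 - z ^+ 2) * (z ^+ 2 - x ^+ 2)) (cst p^-1 * z).
Proof.
move=> p0; have cp : cst p * cst p^-1 = 1 by rewrite -mpolyCM mulfV // mpolyC1.
split.
- rewrite !(rmorphM, rmorphB, rmorphXn) /= !tau_xyz.
  rewrite (_ : _ * _ = (- p ^+ 4)%:P * 'X ^+ 4); last by ring.
  by rewrite mulf_neq0 ?expf_neq0 ?polyX_eq0 // polyC_eq0 oppr_eq0 expf_neq0.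
- by rewrite rmorphM /= tauC tau_xyz mulrA -polyCM mulVf // mul1r.
- by rewrite mpolyC0; apply: (@I7_comb (z ^+ 2 - x ^+ 2) 0 0); ring.
- by rewrite mpolyC0; apply: (@I7_comb 0 (y ^+ 2 - z ^+ 2) 0); ring.
- rewrite mulrA cp mul1r subrr mulr0; exact: is_ideal0 I7_ideal.
Qed.

Lemma base_point_separates p q r :
  base_point p q r -> [|| p != 0, q != 0 | r != 0] ->
  exists u L, separates p q r u L.
Proof.
move=> [pa pb pc]; have [p0|p0] := eqVneq p 0.
  have [q0|q0] := eqVneq q 0; move=> /= r0.
    by rewrite p0 q0; do 2!eexists; apply: z_separates.
  have : r = 0; last move=> r0'.
    apply/eqP; rewrite -sqrf_eq0; move/eqP: pb.
    by rewrite p0 expr0n subr0 mulf_eq0 (negPf q0).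
  by rewrite p0 r0'; do 2!eexists; apply: y_separates.
move=> _; have [q0|q0] := eqVneq q 0.
  have -> : r = 0.
    apply/eqP; move/eqP: pc; rewrite q0 expr0n subr0 mulf_eq0 sqrf_eq0.
    by rewrite (negPf p0) orbF.
  by rewrite q0; do 2!eexists; apply: x_separates.
do 2!eexists; apply: diagonal_separates => //; apply/esym/eqP; last first.
  by move/eqP: pb; rewrite mulf_eq0 (negPf q0) subr_eq0.
have rp : r ^+ 2 = p ^+ 2.
  by apply/eqP; move/eqP: pb; rewrite mulf_eq0 (negPf q0) subr_eq0.
move/eqP: pa; rewrite mulf_eq0 (negPf p0) subr_eq0 rp; exact.
Qed.

(* The radical of [(I7 ^ m : f)] contains the separators of the seven points and
   [I7]; together they generate a power of the maximal ideal. *)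
Lemma symbolic_saturation m f : symbolic_pow I7 m f ->
  exists N, ideal_pow I7 m ((x + y + z) ^+ N * f).
Proof.
move=> fS; have idP := ideal_pow_ideal I7 m.
pose K := [set g | ideal_pow I7 m (g * f)].
have idK : is_ideal K.
  split=> [|g h Kg Kh|u g Kg]; rewrite /K /= ?mul0r ?mulrDl -?mulrA.
  - exact: is_ideal0.
  - exact: is_idealD.
  - exact: is_idealMl.
pose rad := [set g | exists N, K (g ^+ N)].
have radD g h : rad g -> rad h -> rad (g + h) by exact: ideal_radicalD.
have radM u g : rad g -> rad (u * g) by exact: ideal_radicalM.
have radN g : rad g -> rad (- g) by rewrite -mulN1r; exact: radM.
have radX k g : rad (g ^+ k) -> rad g.
  by move=> [N]; rewrite -exprM => Kg; exists (k * N)%N.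
have sep p q r u L : base_point p q r -> separates p q r u L -> rad u.
  by move=> bp su; have [N Ku] := symbolic_separator_pow bp su fS; exists N.
have sign_base (p q : C) : p ^+ 2 = 1 -> q ^+ 2 = 1 -> base_point 1 p q.
  by move=> p1 q1; split; rewrite ?p1 ?q1 ?expr1n subrr mulr0.
have sign_sep (p q : C) : p ^+ 2 = 1 -> q ^+ 2 = 1 ->
    rad ((cst p * x + y) * (cst q * y + cst p * z) * (cst q * x + z)).
  move=> p1 q1; have := sep _ _ _ _ _ (sign_base p q p1 q1)
    (diagonal_separates (oner_neq0 _) (etrans (expr1n _ _) (esym p1))
      (etrans (expr1n _ _) (esym q1))).
  by rewrite mpolyC1 !mul1r.
have half : cst (1 / 8) * 8 = 1.
  rewrite -mpolyC1 (_ : 8 = cst 8); last by rewrite rmorph_nat.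
  by rewrite -mpolyCM; congr cst; field.
have N1 : (-1) ^+ 2 = 1 :> C by rewrite sqrrN expr1n.
have I1 : 1 ^+ 2 = 1 :> C by rewrite expr1n.
have := sign_sep 1 1 I1 I1; have := sign_sep 1 (-1) I1 N1.
have := sign_sep (-1) 1 N1 I1; have := sign_sep (-1) (-1) N1 N1.
rewrite !mpolyCN !mpolyC1 !mulN1r !mul1r => mm mp pm pp.
have square f1 f2 f3 g : rad f1 -> rad f2 -> rad f3 ->
    8 * g = f1 + f2 - f3 -> rad g.
  move=> r1 r2 r3 gE; rewrite -[g]mul1r -half -mulrA gE.
  by apply/radM/radD; [apply: radD | apply: radN].
(* The three sums are [4 x (y^2 + z^2)], [4 y (z^2 + x^2)] and [4 z (x^2 + y^2)]; with the variables
   as coefficients they combine to [8 x^2 y^2] and its permutations. *)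
have xS := radD _ _ (radD _ _ mm mp) (radD _ _ pm pp).
have yS := radD _ _ (radN _ (radD _ _ mm mp)) (radD _ _ pm pp).
have zS := radD _ _ (radN _ (radD _ _ mm pm)) (radD _ _ mp pp).
have xy : rad (x ^+ 2 * y ^+ 2).
  by apply: (square _ _ _ _ (radM x _ xS) (radM y _ yS) (radM z _ zS)); ring.
have xz : rad (x ^+ 2 * z ^+ 2).
  by apply: (square _ _ _ _ (radM x _ xS) (radM z _ zS) (radM y _ yS)); ring.
have yz : rad (y ^+ 2 * z ^+ 2).
  by apply: (square _ _ _ _ (radM y _ yS) (radM z _ zS) (radM x _ xS)); ring.
have axis_base p q r : p * q = 0 -> q * r = 0 -> r * p = 0 -> base_point p q r.
  move=> pq qr rp; split.
  - rewrite (_ : _ * _ = p * q * q - r * p * r); last by ring.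
    by rewrite pq rp !mul0r subr0.
  - rewrite (_ : _ * _ = q * r * r - p * q * p); last by ring.
    by rewrite pq qr !mul0r subr0.
  - rewrite (_ : _ * _ = r * p * p - q * r * q); last by ring.
    by rewrite qr rp !mul0r subr0.
have x_base : base_point 1 0 0 by apply: axis_base; rewrite ?mulr0 ?mul0r.
have y_base : base_point 0 1 0 by apply: axis_base; rewrite ?mulr0 ?mul0r.
have z_base : base_point 0 0 1 by apply: axis_base; rewrite ?mulr0 ?mul0r.
have xN := radN _ (sep _ _ _ _ _ x_base (x_separates (oner_neq0 _))).
have yN := radN _ (sep _ _ _ _ _ y_base (y_separates (oner_neq0 _))).
have zN := radN _ (sep _ _ _ _ _ z_base (z_separates (oner_neq0 _))).
have fourth g f1 f2 f3 f4 : rad f1 -> rad f2 -> rad f3 -> rad f4 ->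
    g ^+ 4 = f1 + f2 - f3 + f4 -> rad g.
  move=> r1 r2 r3 r4 gE; apply: (radX 4); rewrite gE.
  by apply/radD/r4/radD; [apply: radD | apply: radN].
(* The separators of the coordinate points are, up to sign, fourth powers of the variables plus
   combinations of the products just found. *)
have rx : rad x by apply: (fourth _ _ _ _ _ xy xz yz xN); ring.
have ry : rad y by apply: (fourth _ _ _ _ _ xy yz xz yN); ring.
have rz : rad z by apply: (fourth _ _ _ _ _ xz yz xy zN); ring.
by apply/radD/rz/radD/ry.
Qed.

End SevenPoints.

(** * Saturation of the powers in large degrees *)

Section Saturation.
Variable C : numClosedFieldType.
Local Notation A := (mpoly 3 C).
Local Notation cst := (@mpolyC 3 C).
Local Notation x := (mvar C 0).
Local Notation y := (mvar C 1).
Local Notation z := (mvar C 2).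
Local Notation I := (@I7 C).
Local Notation l := (x + y + z).
Local Notation h := (- (x * y + y * z + z * x)).
Local Notation g1 := (y * (z ^+ 2 - x ^+ 2) - z * (x ^+ 2 - y ^+ 2)).
Local Notation g2 := (z * (x ^+ 2 - y ^+ 2) - x * (y ^+ 2 - z ^+ 2)).
Local Notation n := (z * (x ^+ 2 - y ^+ 2)).
Implicit Types (f g u v w phi psi F S : A).

(** * Nonzerodivisors on the plane [x + y + z = 0] *)

Definition pair_ideal u v : set A := [set f | exists p q, f = u * p + v * q].

Lemma pair_ideal_ideal u v : is_ideal (pair_ideal u v).
Proof.
split=> [|_ _ [p [q ->]] [p' [q' ->]]|w _ [p [q ->]]].
- by exists 0, 0; rewrite !mulr0 addr0.
- by exists (p + p'), (q + q'); rewrite !mulrDr addrACA.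
- by exists (w * p), (w * q); rewrite mulrDr !(mulrCA w).
Qed.

Lemma pair_ideal_r u v f : pair_ideal u v (v * f).
Proof. by exists 0, f; rewrite mulr0 add0r. Qed.

Local Notation dvd_l := [set f | exists q, f = l * q].

Lemma dvd_l_ideal : is_ideal dvd_l. Proof. exact: principal_ideal. Qed.

(* The restriction to the plane [x + y + z = 0]. *)
Definition res_l : A -> A := msubst cst x y (- (x + y)).
HB.instance Definition _ := GRing.RMorphism.on res_l.

Lemma res_l0 f : res_l f = 0 <-> dvd_l f.
Proof.
split=> [f0|[q ->]]; last first.
  by rewrite rmorphM !rmorphD /= /res_l !msubst_xyz subrr mul0r.
have := @msubst_congr _ _ cst x y z x y (- (x + y)) dvd_l f dvd_l_ideal.
rewrite msubst_id -/(res_l f) f0 subr0; apply; rewrite /=.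
- by exists 0; rewrite mulr0 subrr.
- by exists 0; rewrite mulr0 subrr.
- by exists 1; ring.
Qed.

Lemma mvar_neq0 k : mvar C k != 0.
Proof.
by rewrite -msupp_eq0 msuppX.
Qed.

Lemma dvd_lM w f : res_l w != 0 -> dvd_l (w * f) -> dvd_l f.
Proof.
move=> w0 /res_l0/eqP; rewrite rmorphM mulf_eq0 (negPf w0) => /eqP.
by move/res_l0.
Qed.

Lemma dvd_l_x f : dvd_l (x * f) -> dvd_l f.
Proof. by apply: dvd_lM; rewrite /res_l msubst_xyz mvar_neq0. Qed.

Lemma pair_ideal_x f k : pair_ideal x l (y ^+ k * f) -> pair_ideal x l f.
Proof.
have idJ := pair_ideal_ideal x l.
pose res : A -> A := msubst cst 0 y (- y).
have resP g : res g = 0 -> pair_ideal x l g.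
  move=> g0; rewrite -[g]subr0 -g0 -{1}[g]msubst_id.
  apply: msubst_congr => //.
  - by exists 1, 0; ring.
  - by exists 0, 0; ring.
  - by exists (-1), 1; ring.
move=> [p [q E]]; apply: resP; apply/eqP.
have /eqP : res (y ^+ k * f) = 0.
  by rewrite E /res !(rmorphD, rmorphM) /= !msubst_xyz; ring.
by rewrite /res rmorphM rmorphXn /= msubst_xyz mulf_eq0 expf_eq0
  (negPf (mvar_neq0 _)) andbF.
Qed.

(* The line [w = l = 0] is parametrised by [(x, c x, d x)]. *)
Lemma pair_ideal_hM (c d : C) w f :
  res_l w != 0 -> msubst cst x (cst c * x) (cst d * x) h != 0 ->
  pair_ideal w l (y - cst c * x) -> pair_ideal w l (z - cst d * x) ->
  msubst cst x (cst c * x) (cst d * x) w = 0 ->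
  msubst cst x (cst c * x) (cst d * x) l = 0 ->
  pair_ideal h l (w * f) -> pair_ideal h l f.
Proof.
move=> w0 h0 wy wz resw resl [p [q E]].
pose res := msubst cst x (cst c * x) (cst d * x).
(* On the line [w = l = 0] the relation becomes [h p = 0] with [h] nonzero, so [p] vanishes
   there. *)
have [p1 [p2 pE]] : pair_ideal w l p.
  have := @msubst_congr _ _ cst x y z x (cst c * x) (cst d * x) _ p
    (pair_ideal_ideal w l).
  rewrite msubst_id; have -> : msubst cst x (cst c * x) (cst d * x) p = 0.
    apply/eqP; rewrite -[_ == 0]/(false || _) -(negPf h0) -mulf_eq0 -rmorphM.
    rewrite (_ : h * p = w * f - l * q) ?rmorphB ?rmorphM /= ?resw ?resl.
      by rewrite !mul0r subrr.
    by rewrite E addrK.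
  rewrite subr0; apply=> //; exists 0, 0; ring.
have [s sE] : dvd_l (f - h * p1).
  apply: (dvd_lM w0); exists (q + h * p2).
  by rewrite mulrBr E pE; ring.
by exists p1, s; rewrite -sE addrC subrK.
Qed.

(** Modulo [l], [n] is [-(x + y)^2 (x - y)]. On the plane, the two linear factors vanish at
    [(1 : -1 : 0)] and [(1 : 1 : -2)], where [h] takes the values 1 and 3. *)
Lemma pair_ideal_n k f : pair_ideal h l (n ^+ k * f) -> pair_ideal h l f.
Proof.
have idJ := pair_ideal_ideal h l.
elim: k => [|k IHk]; first by rewrite mul1r.
rewrite exprS -mulrA; set g := n ^+ k * f => Jg; apply: IHk.
have {Jg} : pair_ideal h l ((x + y) * ((x + y) * ((x - y) * g))).
  rewrite (_ : (x + y) * _ = l * ((x ^+ 2 - y ^+ 2) * g) - n * g); last by ring.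
  by apply: is_idealB => //; apply: pair_ideal_r.
have res3 (c : C) : c != 0 -> cst c * x ^+ 2 != 0.
  by move=> c0; rewrite mulf_neq0 ?mpolyC_eq0 // expf_neq0 ?mvar_neq0.
have res1 f' : tau 1 0 0 f' = 'X -> f' != 0.
  by apply: contra_eq_neq => ->; rewrite rmorph0 eq_sym polyX_eq0.
have xDy f' : pair_ideal h l ((x + y) * f') -> pair_ideal h l f'.
  apply: (@pair_ideal_hM (-1) 0).
  - rewrite rmorphD /= /res_l !msubst_xyz; apply: res1.
    by rewrite rmorphD /= !tau_xyz polyC0 polyC1; ring.
  - rewrite rmorphN !(rmorphD, rmorphM) /= !msubst_xyz mpolyC0 mpolyCN mpolyC1.
    rewrite [X in X != _](_ : _ = x ^+ 2); last by ring.
    by rewrite -[x ^+ 2]mul1r -mpolyC1 res3 ?oner_neq0.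
  - by exists 1, 0; rewrite mpolyCN mpolyC1; ring.
  - by exists (-1), 1; rewrite mpolyC0; ring.
  - by rewrite rmorphD /= !msubst_xyz mpolyCN mpolyC1; ring.
  - by rewrite !rmorphD /= !msubst_xyz mpolyC0 mpolyCN mpolyC1; ring.
have cst2 : cst (-2) = -2 by rewrite mpolyCN rmorph_nat.
move=> /xDy/xDy; apply: (@pair_ideal_hM 1 (-2)).
- rewrite rmorphB /= /res_l !msubst_xyz; apply: res1.
  by rewrite rmorphB /= !tau_xyz polyC0 polyC1; ring.
- rewrite rmorphN !(rmorphD, rmorphM) /= !msubst_xyz cst2 mpolyC1.
  rewrite [X in X != _](_ : _ = 3 * x ^+ 2); last by ring.
  by rewrite -(rmorph_nat cst) res3 ?pnatr_eq0.
- by exists (-1), 0; rewrite mpolyC1; ring.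
- by exists 1, 1; rewrite cst2; ring.
- by rewrite rmorphB /= !msubst_xyz mpolyC1; ring.
- by rewrite !rmorphD /= !msubst_xyz cst2 mpolyC1; ring.
Qed.

Lemma is_form_l : is_form 1 l.
Proof.
exact: is_formD (is_formD (is_form_x C) (is_form_y C)) (is_form_z C).
Qed.

Lemma is_form_h : is_form 2 h.
Proof.
apply: is_formN; apply: is_formD; first apply: is_formD.
- exact: (is_formM (is_form_x C) (is_form_y C)).
- exact: (is_formM (is_form_y C) (is_form_z C)).
- exact: (is_formM (is_form_z C) (is_form_x C)).
Qed.

Lemma is_form_cubic u v w : is_form 1 u -> is_form 1 v -> is_form 1 w ->
  is_form 3 (u * (v ^+ 2 - w ^+ 2)).
Proof.
move=> u1 v1 w1; apply: (is_formM u1 (j := 2)).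
by apply: is_formB; [exact: (is_formX 2 v1) | exact: (is_formX 2 w1)].
Qed.

Lemma is_form_n : is_form 3 n.
Proof. exact: is_form_cubic (is_form_z C) (is_form_x C) (is_form_y C). Qed.

Lemma is_form_g1 : is_form 3 g1.
Proof.
apply: is_formB is_form_n.
exact: is_form_cubic (is_form_y C) (is_form_z C) (is_form_x C).
Qed.

Lemma is_form_g2 : is_form 3 g2.
Proof.
apply: is_formB is_form_n _.
exact: is_form_cubic (is_form_x C) (is_form_y C) (is_form_z C).
Qed.

Lemma pair_ideal_order f k : order_ge k f -> pair_ideal h l f ->
  exists g q, f = h * g + l * q /\ order_ge (k - 2)%N g.
Proof.
move=> f_k [g [q fE]]; have [le2k|lt_k2] := leqP 2 k; last first.
  by exists g, q; split=> // d; have -> : (k - 2 = 0)%N by lia.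
exists (g - low (k - 2) g), (q - low (k - 1) q); split; last first.
  exact: order_ge_high.
have lowE d u v : (d <= k)%N -> is_form d u -> low k (u * v) = u * low (k - d) v.
  by move=> /subnK {1}<- du; apply: low_formM.
have E : h * low (k - 2) g + l * low (k - 1) q = 0.
  rewrite -(lowE 2 _ _ _ is_form_h) // -(lowE 1 _ _ (ltnW le2k) is_form_l) -lowD.
  by rewrite -fE low_order_ge.
by rewrite fE -[LHS]subr0 -E; ring.
Qed.

Lemma I_g1 : I g1.
Proof. exact: is_idealB (I7_ideal C) (I7b C) (I7c C). Qed.
Lemma I_g2 : I g2.
Proof. exact: is_idealB (I7_ideal C) (I7c C) (I7a C). Qed.

(* Modulo [l], [g1 = x h] and [g2 = y h]: the relation associates to a form
   [sum_i c_i x^i y^(j-i)] a lift of its product with [h ^ j] to the [j]-th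
   power of the ideal. *)
Fixpoint lift_rel j f phi : Prop :=
  if j is j'.+1 then
    exists f' phi' u, [/\ lift_rel j' f' phi', f = x * f' + y ^+ j * u
                         & phi = g1 * phi' + g2 ^+ j * u]
  else f = phi.

(** * Lifts to powers of the ideal *)

Lemma lift_rel0 j : lift_rel j 0 0.
Proof. by elim: j => [|j IHj] //=; exists 0, 0, 0; rewrite !mulr0 !addr0. Qed.

Lemma lift_relD j f phi f' phi' :
  lift_rel j f phi -> lift_rel j f' phi' -> lift_rel j (f + f') (phi + phi').
Proof.
elim: j f phi f' phi' => [|j IHj] f phi f' phi' /=; first by move=> -> ->.
move=> [f1 [p1 [u1 [r1 -> ->]]]] [f2 [p2 [u2 [r2 -> ->]]]].
exists (f1 + f2), (p1 + p2), (u1 + u2); split; first exact: IHj.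
  by rewrite !mulrDr addrACA.
by rewrite !mulrDr addrACA.
Qed.

Lemma lift_relZ j u f phi : lift_rel j f phi -> lift_rel j (u * f) (u * phi).
Proof.
elim: j f phi => [|j IHj] f phi /=; first by move=> ->.
move=> [f1 [p1 [u1 [r1 -> ->]]]]; exists (u * f1), (u * p1), (u * u1).
by split; [exact: IHj | rewrite mulrDr !(mulrCA u) | rewrite mulrDr !(mulrCA u)].
Qed.

Lemma lift_relB j f phi f' phi' :
  lift_rel j f phi -> lift_rel j f' phi' -> lift_rel j (f - f') (phi - phi').
Proof.
move=> r r'; have := lift_relD r (lift_relZ (-1) r').
by rewrite !mulN1r.
Qed.

Lemma lift_relx j f phi : lift_rel j f phi -> lift_rel j.+1 (x * f) (g1 * phi).
Proof. by move=> r; exists f, phi, 0; rewrite !mulr0 !addr0. Qed.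

Lemma lift_rel_y j u : lift_rel j (y ^+ j * u) (g2 ^+ j * u).
Proof.
case: j => [|j] /=; first by rewrite !expr0.
by exists 0, 0, u; split; rewrite ?mulr0 ?add0r //; apply: lift_rel0.
Qed.

Lemma lift_rely j f phi : lift_rel j f phi -> lift_rel j.+1 (y * f) (g2 * phi).
Proof.
elim: j f phi => [|j IHj] f phi.
  by move=> ->; have := @lift_rel_y 1 phi; rewrite !expr1.
move=> [f1 [p1 [u1 [r1 -> ->]]]]; exists (y * f1), (g2 * p1), u1.
split; first exact: IHj.
  by rewrite [y ^+ j.+2]exprS; ring.
by rewrite [g2 ^+ j.+2]exprS; ring.
Qed.

Lemma lift_relM i j f phi f' phi' :
  lift_rel i f phi -> lift_rel j f' phi' ->
  lift_rel (i + j)%N (f * f') (phi * phi').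
Proof.
have regroup u v u' v' w : (u * v + u' * v') * w = u * (v * w) + v' * (u' * w).
  ring.
elim: i f phi => [|i IHi] f phi; first by move=> -> r; apply: lift_relZ.
move=> [f1 [p1 [u1 [r1 -> ->]]]] r; rewrite !regroup.
apply: lift_relD; first exact: lift_relx (IHi _ _ r1 r).
apply: lift_relZ; move: i.+1 => k; clear -r.
elim: k => [|k IHk]; first by rewrite !expr0 !mul1r.
by rewrite (exprS y) (exprS g2) -(mulrA y) -(mulrA g2); apply: lift_rely.
Qed.

Lemma lift_rel_order j f phi : lift_rel j f phi -> order_ge j f.
Proof.
elim: j f phi => [|j IHj] f phi; first by move=> _; apply: (@order_ge0 C f).
have idO := order_ge_ideal C j.+1.
move=> [f1 [p1 [u1 [r1 -> _]]]]; apply: (is_idealD idO).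
  exact: order_geM (order_ge_form (is_form_x C)) (IHj _ _ r1).
apply: (is_idealMr _ idO); rewrite -{1}[j.+1]mul1n.
exact/order_ge_form/is_formX/is_form_y.
Qed.

Lemma lift_rel_l j f phi : lift_rel j f phi -> dvd_l (phi - h ^+ j * f).
Proof.
have idl := dvd_l_ideal; have mulD (u v u' v' : A) :
    u * v - u' * v' = (u - u') * v + u' * (v - v') by ring.
elim: j f phi => [|j IHj] f phi.
  by move=> ->; rewrite mul1r subrr; apply: is_ideal0.
move=> [f1 [p1 [u1 [r1 -> ->]]]].
have -> : g1 * p1 + g2 ^+ j.+1 * u1 - h ^+ j.+1 * (x * f1 + y ^+ j.+1 * u1) =
    (g1 * p1 - (h * x) * (h ^+ j * f1)) + (g2 ^+ j.+1 - (h * y) ^+ j.+1) * u1.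
  by rewrite exprMn [h ^+ j.+1]exprS; ring.
apply: is_idealD => //.
  rewrite mulD; apply: is_idealD => //; last exact/(is_idealMl _ idl)/IHj.
  by apply: is_idealMr => //; exists (y * z); ring.
apply: is_idealMr => //; rewrite subrXX; apply: is_idealMr => //.
by exists (x * z); ring.
Qed.

(* The relation [y g1 - x g2 = - l n] makes the lift well defined. *)
Lemma lift_rel_dvd j f phi : lift_rel j f phi -> dvd_l f ->
  exists w, ideal_pow I j w /\ phi = l * w.
Proof.
elim: j f phi => [|j IHj] f phi.
  by move=> -> [q ->]; exists q; split=> //; apply: ideal_pow0.
have idP := ideal_pow_ideal I j.+1.
move=> [f1 [p1 [u1 [r1 -> ->]]]] [q E].
(* On the line [x = l = 0] only [y ^+ j.+1 * u1] remains of [f], so [u1 = x c1 + l c2]; the part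
   [x c1] is then moved into [f1]. *)
have [c1 [c2 u1E]] : pair_ideal x l u1.
  apply: (@pair_ideal_x _ j.+1); exists (- f1), q; rewrite -E; ring.
have [|w [Pw wE]] := IHj _ _ (lift_relD r1 (lift_rel_y j (y * c1))).
  apply: dvd_l_x; exists (q - y ^+ j.+1 * c2).
  by rewrite mulrBr -E u1E exprS; ring.
(* Moving [x c1] leaves [g2^j c1 (x g2 - y g1) = l n g2^j c1], the source of the middle term. *)
exists (g1 * w + n * (g2 ^+ j * c1) + g2 ^+ j.+1 * c2); split.
  have g2P k : ideal_pow I k (g2 ^+ k).
    by have := ideal_powX k (mem_ideal_pow1 I_g2); rewrite mul1n.
  apply: is_idealD => //; last by apply: is_idealMr.
  apply: is_idealD => //; first exact: ideal_powM (mem_ideal_pow1 I_g1) Pw.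
  rewrite mulrA; apply: is_idealMr => //.
  exact: ideal_powM (mem_ideal_pow1 (I7c C)) (g2P j).
have -> : p1 = l * w - g2 ^+ j * (y * c1) by rewrite -wE addrK.
rewrite u1E [g2 ^+ j.+1]exprS; ring.
Qed.

(** The polynomials with a lift modulo [l] form a multiplicative filtration with [x], [y] and hence
    [z], which is [-(x + y)] modulo [l], in step 1. *)
Lemma lift_rel_surj j f : order_ge j f ->
  exists f' phi, lift_rel j f' phi /\ dvd_l (f - f').
Proof.
have idl := dvd_l_ideal.
pose N k : set A := [set g | exists f' phi, lift_rel k f' phi /\ dvd_l (g - f')].
have ND k g g' : N k g -> N k g' -> N k (g + g').
  move=> [f1 [p1 [r1 d1]]] [f2 [p2 [r2 d2]]]; exists (f1 + f2), (p1 + p2).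
  by split; [exact: lift_relD | rewrite opprD addrACA; exact: is_idealD].
have NM i k g g' : N i g -> N k g' -> N (i + k)%N (g * g').
  move=> [f1 [p1 [r1 d1]]] [f2 [p2 [r2 d2]]]; exists (f1 * f2), (p1 * p2).
  split; first exact: lift_relM.
  have -> : g * g' - f1 * f2 = (g - f1) * g' + f1 * (g' - f2) by ring.
  by apply: is_idealD => //; [apply: is_idealMr | apply: is_idealMl].
have N0 k : N k 0.
  by exists 0, 0; split; [exact: lift_rel0 | rewrite subrr; exact: is_ideal0].
have NC g : N 0%N g.
  by exists g, g; split=> //; rewrite subrr; apply: is_ideal0.
have Nx : N 1%N x.
  exists x, g1; rewrite subrr; split; last exact: is_ideal0.
  by have := @lift_relx 0 1 1 erefl; rewrite !mulr1.
have Ny : N 1%N y.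
  exists y, g2; rewrite subrr; split; last exact: is_ideal0.
  by have := @lift_rely 0 1 1 erefl; rewrite !mulr1.
have Nz : N 1%N z.
  have [fx [px [rx [qx dx]]]] := Nx; have [fy [py [ry [qy dy]]]] := Ny.
  exists (-1 * (fx + fy)), (-1 * (px + py)); split.
    exact/lift_relZ/lift_relD.
  by exists (1 - qx - qy); rewrite 2!mulrBr -dx -dy; ring.
(* A lift of level [k + 1] gives one of level [k] for the same polynomial: one factor [g1] or [g2]
   is replaced by [x] or [y]. *)
have Nle i k g : (i <= k)%N -> N k g -> N i g.
  move=> /subnK <-; move: (k - i)%N => {}k; elim: k => [|k IHk] //.
  move=> [f1 [p1 [[f2 [p2 [u2 [r2 f1E _]]]] d1]]]; apply: IHk.
  exists f1, (x * p2 + y * (g2 ^+ (k + i) * u2)); split=> //.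
  rewrite f1E; apply: lift_relD; first exact: lift_relZ.
  by rewrite exprS -mulrA; apply: lift_relZ; apply: lift_rel_y.
have idN : is_ideal (N j).
  split=> [||u g]; [exact: N0 | exact: ND |].
  by rewrite -[j]add0n; apply: NM.
move=> f_j; apply: (mem_order_ge idN f_j) => d le_jd.
by apply: (Nle _ _ _ le_jd); apply: Phi_filtration.
Qed.

(* [S = sum_j n^(i+k-j) phi_j] for [i <= j <= i + k], where [phi_j] lifts [f_j]
   to the [j]-th power; modulo [l], [S] is [h ^ i * F]. *)
Fixpoint lift_sum e k i F S : Prop :=
  if k is k'.+1 then
    exists f phi F' S', [/\ lift_rel i f phi, order_ge (i + e)%N f,
      lift_sum e k' i.+1 F' S', F = n ^+ k * f + h * F'
      & S = n ^+ k * phi + S']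
  else lift_rel i F S /\ order_ge (i + e)%N F.

(** * Sums of lifts with powers of [n] *)

Lemma lift_sum_head e k i f phi F S :
  lift_rel i f phi -> order_ge (i + e)%N f -> lift_sum e k i F S ->
  lift_sum e k i (F + n ^+ k * f) (S + n ^+ k * phi).
Proof.
move=> r o; case: k => [|k] /=.
  move=> [r' o']; rewrite !expr0 !mul1r; split; first exact: lift_relD.
  exact: (is_idealD (order_ge_ideal C _)).
move=> [f1 [p1 [F1 [S1 [r1 o1 s1 -> ->]]]]].
exists (f1 + f), (p1 + phi), F1, S1; split=> //.
- exact: lift_relD.
- exact: (is_idealD (order_ge_ideal C _)).
- by ring.
- by ring.
Qed.

Lemma lift_sum0 e k i : lift_sum e k i 0 0.
Proof.
elim: k i => [|k IHk] i /=.
  by split; [exact: lift_rel0 | exact: (is_ideal0 (order_ge_ideal C _))].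
exists 0, 0, 0, 0; rewrite !mulr0 !addr0; split=> //; first exact: lift_rel0.
exact: (is_ideal0 (order_ge_ideal C _)).
Qed.

Lemma lift_sumD e k i F S F' S' : lift_sum e k i F S -> lift_sum e k i F' S' ->
  lift_sum e k i (F + F') (S + S').
Proof.
elim: k i F S F' S' => [|k IHk] i F S F' S' /=.
  move=> [r o] [r' o']; split; first exact: lift_relD.
  exact: (is_idealD (order_ge_ideal C _)).
move=> [f1 [p1 [F1 [S1 [r1 o1 s1 -> ->]]]]] [f2 [p2 [F2 [S2 [r2 o2 s2 -> ->]]]]].
exists (f1 + f2), (p1 + p2), (F1 + F2), (S1 + S2); split.
- exact: lift_relD.
- exact: (is_idealD (order_ge_ideal C _)).
- exact: IHk.
- by ring.
- by ring.
Qed.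

Lemma lift_sum_n e k i F S : lift_sum e k i F S ->
  lift_sum e k.+1 i (n * F) (n * S).
Proof.
elim: k i F S => [|k IHk] i F S.
  move=> [r o]; exists F, S, 0, 0; rewrite mulr0 !addr0 expr1; split=> //.
  exact: lift_sum0.
move=> [f1 [p1 [F1 [S1 [r1 o1 s1 -> ->]]]]].
exists f1, p1, (n * F1), (n * S1); split=> //; first exact: IHk.
  by rewrite [n ^+ k.+2]exprS; ring.
by rewrite [n ^+ k.+2]exprS; ring.
Qed.

(** For multiplication by [g1] or [g2], with [u = x] or [u = y]: every lift moves up one power, the
    exponents of [n] stay. *)
Lemma lift_sum_shift e k i F S u g :
  is_form 1 u ->
  (forall j f phi, lift_rel j f phi -> lift_rel j.+1 (u * f) (g * phi)) ->
  lift_sum e k i F S -> lift_sum e k i.+1 (u * F) (g * S).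
Proof.
move=> u1 rg; have uo j f : order_ge j f -> order_ge j.+1 (u * f).
  exact: (order_geM (order_ge_form u1)).
elim: k i F S => [|k IHk] i F S /=.
  by move=> [r o]; split; [exact: rg | exact: uo].
move=> [f1 [p1 [F1 [S1 [r1 o1 s1 -> ->]]]]].
exists (u * f1), (g * p1), (u * F1), (g * S1); split.
- exact: rg.
- exact: uo.
- exact: IHk.
- by ring.
- by ring.
Qed.

Lemma lift_sum_cons0 e k i F S :
  lift_sum e k i.+1 F S -> lift_sum e k.+1 i (h * F) S.
Proof.
move=> s; exists 0, 0, F, S; rewrite !mulr0 !add0r; split=> //.
  exact: lift_rel0.
exact: (is_ideal0 (order_ge_ideal C _)).
Qed.

Lemma lift_sum_l e k i F S : lift_sum e k i F S -> dvd_l (S - h ^+ i * F).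
Proof.
have idl := dvd_l_ideal.
elim: k i F S => [|k IHk] i F S; first by move=> [r _]; apply: lift_rel_l.
move=> [f1 [p1 [F1 [S1 [r1 o1 s1 -> ->]]]]].
have -> : n ^+ k.+1 * p1 + S1 - h ^+ i * (n ^+ k.+1 * f1 + h * F1) =
    n ^+ k.+1 * (p1 - h ^+ i * f1) + (S1 - h ^+ i.+1 * F1).
  by rewrite [h ^+ i.+1]exprS; ring.
apply: is_idealD => //; last exact: IHk.
exact/(is_idealMl _ idl)/lift_rel_l.
Qed.

Lemma res_l_h : res_l h != 0.
Proof.
rewrite rmorphN !(rmorphD, rmorphM) /= /res_l !msubst_xyz.
have : tau 1 0 0 (x ^+ 2 + x * y + y ^+ 2) = 'X ^+ 2.
  by rewrite !(rmorphD, rmorphM, rmorphXn) /= !tau_xyz polyC0 polyC1; ring.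
apply: contra_eq_neq => E; rewrite (_ : _ + _ + _ = 0).
  by rewrite rmorph0 eq_sym expf_eq0 polyX_eq0.
by rewrite -E; ring.
Qed.

(* The syzygy [h n = x z g1 - y z g2] moves a multiple of [h] from one term of
   the sum to the next. *)
Lemma lift_sum_dvd e k i F S : (e <= 2)%N -> (e == 2%N) || (k + i <= 1)%N ->
  lift_sum e k i F S -> dvd_l F ->
  exists w, ideal_pow I (k + i)%N w /\ S = l * w.
Proof.
move=> le_e2; elim: k i F S => [|k IHk] i F S eki.
  by move=> [r _]; apply: lift_rel_dvd.
have idP := ideal_pow_ideal I (k.+1 + i).
move=> [f [phi [F' [S' [r o s -> ->]]]]] [q0 q0E].
(* The other terms of the sum carry a factor [h], so [n^(k+1) f] lies in [(h, l)], modulo which [n]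
   is a nonzerodivisor. *)
have [|g [q [fE g_o]]] := pair_ideal_order o.
  apply: (@pair_ideal_n k.+1); exists (- F'), q0.
  by rewrite -q0E; ring.
(* The order [i + e - 2] of [g] is at least [i] if [e = 2]; otherwise [k + 1 + i <= 1] forces
   [i = 0]. *)
have [|g' [psi [r' [q1 g'E]]]] := @lift_rel_surj i g.
  by apply: order_ge_le g_o; lia.
have [|w1 [w1P w1E]] := lift_rel_dvd (lift_relB r (lift_relZ h r')).
  by exists (h * q1 + q); rewrite fE mulrDr mulrCA -g'E; ring.
(* The syzygy turns [h n psi] into a lift of [n g'] one power higher. *)
have r'' : lift_rel i.+1 (n * g') ((x * z * g1 - y * z * g2) * psi).
  have := lift_relB (lift_relZ (x * z) (lift_relx r'))
    (lift_relZ (y * z) (lift_rely r')).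
  have -> : x * z * (x * g') - y * z * (y * g') = n * g' by ring.
  by have -> : x * z * (g1 * psi) - y * z * (g2 * psi) =
    (x * z * g1 - y * z * g2) * psi by ring.
(* The order is at least [i + 3], which suffices as [e <= 2]. *)
have o'' : order_ge (i.+1 + e)%N (n * g').
  apply: order_ge_le (order_geM (order_ge_form is_form_n) (lift_rel_order r')).
  by lia.
have [||w2 [w2P w2E]] := IHk i.+1 _ _ _ (lift_sum_head r'' o'' s).
- by lia.
- apply: (dvd_lM (w := h)).
    exact: res_l_h.
  have hF : h * F' = l * q0 - n ^+ k.+1 * f by rewrite -q0E; ring.
  have gE : g = g' + l * q1 by rewrite -g'E addrC subrK.
  exists (q0 - n ^+ k.+1 * (h * q1 + q)).
  by rewrite mulrDr hF fE gE [n ^+ k.+1]exprS; ring.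
exists (n ^+ k.+1 * w1 + w2); split.
  apply: is_idealD => //; last by rewrite addSnnS.
  apply: ideal_powM => //.
  by have := ideal_powX k.+1 (mem_ideal_pow1 (I7c C)); rewrite mul1n.
have -> : phi = h * psi + l * w1 by rewrite -w1E addrC subrK.
have -> : S' = l * w2 - n ^+ k * ((x * z * g1 - y * z * g2) * psi).
  by rewrite -w2E addrK.
by rewrite [n ^+ k.+1]exprS; ring.
Qed.

(** * Powers of the ideal as combinations of [g1], [g2] and [n] *)

(** This is [I^r (x, y, z)^e], nested so that the order of the coefficients is recorded. *)
Fixpoint power_comb e r : set A :=
  if r is r'.+1 then
    [set f | exists p q s, [/\ power_comb e r' p, power_comb e r' q,
       power_comb e r' s & f = g1 * p + g2 * q + n * s]]
  else order_ge e.

Lemma power_comb_ideal e r : is_ideal (power_comb e r).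
Proof.
elim: r => [|r IHr]; first exact: order_ge_ideal.
split=> [|f f' [p [q [s [Pp Pq Ps ->]]]] [p' [q' [s' [Pp' Pq' Ps' ->]]]]
        |u f [p [q [s [Pp Pq Ps ->]]]]] /=.
- by exists 0, 0, 0; rewrite !mulr0 !addr0; split=> //; apply: is_ideal0.
- exists (p + p'), (q + q'), (s + s'); split; try exact: is_idealD.
  by ring.
- exists (u * p), (u * q), (u * s); split; try exact: is_idealMl.
  by ring.
Qed.

Lemma power_comb_I7 e r f g :
  I f -> power_comb e r g -> power_comb e r.+1 (f * g).
Proof.
move=> If Pg; have idr := power_comb_ideal e r.
have id := power_comb_ideal e r.+1; move: f If; apply: I7_min.
- split=> [|u v Ju Jv|u v Jv]; rewrite /= ?mul0r ?mulrDl -?mulrA.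
  + exact: is_ideal0 id.
  + exact: is_idealD id Ju Jv.
  + exact: is_idealMl id Jv.
- exists 0, (- g), g; split; rewrite ?mulr0;
    [exact: is_ideal0 | exact: is_idealN | by [] |].
  by ring.
- exists g, 0, g; split; rewrite ?mulr0; [by []|exact: is_ideal0|by []|].
  by ring.
- exists 0, 0, g; split; rewrite ?mulr0; [exact: is_ideal0|exact: is_ideal0|by []|].
  by ring.
Qed.

Lemma ideal_pow_comb r f : ideal_pow I r f -> power_comb 0 r f.
Proof.
move: f; apply: ideal_pow_min; first exact: power_comb_ideal.
elim: r => [|r IHr] s Is; first exact: (@order_ge0 C).
rewrite big_ord_recl; apply: power_comb_I7 => //.
by apply: IHr => i; apply: Is.
Qed.

Lemma power_comb_Phi d r f :
  power_comb 0 r f -> power_comb d r (Phi f)`_(d + 3 * r).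
Proof.
elim: r f => [|r IHr] f.
  by move=> _; rewrite muln0 addn0; apply/order_ge_form/is_form_Phi.
move=> [p [q [s [Pp Pq Ps ->]]]]; rewrite mulnS addnCA addnC.
rewrite !rmorphD !coefD (coef_PhiM _ _ is_form_g1) (coef_PhiM _ _ is_form_g2).
rewrite (coef_PhiM _ _ is_form_n).
by do 3!eexists; split; last reflexivity; apply: IHr.
Qed.

Lemma power_comb_le d e r f : (e <= d)%N -> power_comb d r f -> power_comb e r f.
Proof.
move=> le_ed; elim: r f => [|r IHr] f /=; first exact: order_ge_le.
by move=> [p [q [s [Pp Pq Ps ->]]]]; exists p, q, s; split=> //; apply: IHr.
Qed.

(** The generators are cubics, so the component of degree [d] needs only coefficients of degree
    [d - 3 r]. *)
Lemma ideal_pow_order_comb r e f :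
  ideal_pow I r f -> order_ge (3 * r + e)%N f -> power_comb e r f.
Proof.
move=> Pf f_o; apply: (mem_order_ge (power_comb_ideal e r) f_o) => d le_d.
apply: (@power_comb_le (d - 3 * r)); first by lia.
have -> : d = (d - 3 * r + 3 * r)%N by lia.
rewrite addnK; exact: power_comb_Phi (ideal_pow_comb Pf).
Qed.

Lemma power_comb_lift_sum e r f : power_comb e r f -> exists F, lift_sum e r 0 F f.
Proof.
elim: r f => [|r IHr] f; first by exists f.
move=> [p [q [s [/IHr[P pP] /IHr[Q qQ] /IHr[R sR] ->]]]].
have pP' := lift_sum_cons0 (lift_sum_shift (is_form_x C) lift_relx pP).
have qQ' := lift_sum_cons0 (lift_sum_shift (is_form_y C) lift_rely qQ).
by eexists; exact: lift_sumD (lift_sumD pP' qQ') (lift_sum_n sR).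
Qed.

(* The local cohomology module [H^0_m(A / I^r)] vanishes in degrees greater than
   [3 r], and altogether for [r = 1]. *)
Lemma ideal_pow_saturated r g : ideal_pow I r (l * g) ->
  (r <= 1)%N \/ order_ge (3 * r + 2)%N (l * g) -> ideal_pow I r g.
Proof.
move=> Pg r_o.
(* For [r <= 1] coefficients of order 0 suffice; in general the syzygy argument takes order 2. *)
have [e [le_e2 e_r [F sF]]] : exists e, [/\ (e <= 2)%N,
    (e == 2%N) || (r + 0 <= 1)%N & exists F, lift_sum e r 0 F (l * g)].
  case: r_o => [le_r1|g_o].
    exists 0%N; rewrite addn0 le_r1; split=> //.
    exact/power_comb_lift_sum/ideal_pow_comb.
  by exists 2; split=> //; apply/power_comb_lift_sum/ideal_pow_order_comb.
have [|w [Pw /mulfI->]] := lift_sum_dvd le_e2 e_r sF.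
- have [q] := lift_sum_l sF; rewrite expr0 mul1r => E.
  by exists (g - q); rewrite mulrBr -E; ring.
- by rewrite addn0 in Pw.
have res1 : tau 1 0 0 l = 'X by rewrite !rmorphD /= !tau_xyz polyC0 polyC1; ring.
by apply: contra_eq_neq res1 => ->; rewrite rmorph0 eq_sym polyX_eq0.
Qed.

End Saturation.

(** * Initial degree of the symbolic powers *)

Section InitialDegree.
Variable C : numClosedFieldType.
Local Notation A := (mpoly 3 C).
Local Notation cst := (@mpolyC 3 C).
Local Notation x := (mvar C 0).
Local Notation y := (mvar C 1).
Local Notation z := (mvar C 2).
Local Notation I := (@I7 C).
Implicit Types (f g s F : A).

(** * Polynomials as functions *)

Definition ev (p q r : C) : A -> C := msubst idfun p q r.
HB.instance Definition _ p q r := GRing.RMorphism.on (ev p q r).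

Lemma ev_xyz p q r : (ev p q r x = p) * (ev p q r y = q) * (ev p q r z = r).
Proof. by rewrite /ev !msubst_xyz. Qed.

Lemma evC p q r c : ev p q r (cst c) = c.
Proof. exact: msubstC. Qed.

Lemma ev_Phi p q r f d : ev p q r (Phi f)`_d = (tau p q r f)`_d.
Proof.
rewrite -coef_map /=; suff -> : map_poly (ev p q r) (Phi f) = tau p q r f by [].
apply: (rmorph_ext3 (h := map_poly (ev p q r) \o @Phi C)) => [c|||] /=;
  by rewrite ?Phi_xyz ?PhiC ?tauC ?tau_xyz ?rmorphM /= ?map_polyC ?map_polyX /=
    ?ev_xyz ?evC.
Qed.

(** In characteristic 0 the images of the first [size p] natural numbers are too many distinct
    roots. *)
Lemma poly_vanishing (R : idomainType) (iota : {rmorphism C -> R}) (p : {poly R}) :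
  (forall c, p.[iota c] = 0) -> p = 0.
Proof.
move=> p0; apply/eqP; apply: contraT => p_n0.
have := @max_poly_roots _ p [seq iota i%:R | i <- seq.iota 0 (size p)] p_n0.
rewrite size_map size_iota ltnn; apply.
  by apply/allP => _ /mapP[i _ ->]; apply/eqP/p0.
rewrite map_inj_uniq ?iota_uniq // => i j /fmorph_inj/eqP.
by rewrite eqr_nat => /eqP.
Qed.

Lemma msubst_vanishing (a b c : {poly A}) u F :
  (forall t, msubst cst a.[cst t] b.[cst t] c.[cst t] F = 0) ->
  msubst cst a.[u] b.[u] c.[u] F = 0.
Proof.
have hornerE' v :
    (msubst (polyC \o cst) a b c F).[v] = msubst cst a.[v] b.[v] c.[v] F.
  apply: (rmorph_ext3 (h := horner_eval v \o msubst (polyC \o cst) a b c))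
    => [d|||]; by rewrite /= /horner_eval ?msubst_xyz // !msubstC hornerC.
move=> F0; rewrite -hornerE' (_ : msubst _ _ _ _ _ = 0) ?horner0 //.
by apply: (@poly_vanishing _ cst) => t; rewrite hornerE' F0.
Qed.

Lemma mpoly_vanishing F : (forall p q r, ev p q r F = 0) -> F = 0.
Proof.
move=> F0; rewrite -[F]msubst_id.
have := @msubst_vanishing x%:P y%:P 'X z F; rewrite !hornerE; apply=> r.
have := @msubst_vanishing x%:P 'X (cst r)%:P y F; rewrite !hornerE; apply=> q.
have := @msubst_vanishing 'X (cst q)%:P (cst r)%:P x F; rewrite !hornerE; apply=> p.
rewrite ?hornerE -(rmorph0 cst) -(F0 p q r).
apply: (rmorph_ext3 (k := cst \o ev p q r)) => [c|||];
  by rewrite /= ?msubst_xyz ?ev_xyz ?msubstC ?evC.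
Qed.

Lemma horner_msubst (a b c : {poly C}) e g :
  map_poly (horner_eval e)
    (msubst (polyC \o polyC) (a%:P * 'X) (b%:P * 'X) (c%:P * 'X) g) =
  tau a.[e] b.[e] c.[e] g.
Proof.
apply: (rmorph_ext3 (h := map_poly (horner_eval e) \o
  msubst (polyC \o polyC) (a%:P * 'X) (b%:P * 'X) (c%:P * 'X))) => [d|||] /=;
  by rewrite ?msubst_xyz ?msubstC ?tau_xyz ?tauC /= ?rmorphM /= ?map_polyC
    ?map_polyX /= /horner_eval ?hornerC.
Qed.

Lemma tau_base_point p q r :
  (forall g, I g -> tau p q r g = 0) -> base_point p q r.
Proof.
move=> vanish; have coef3 (u : C) : u%:P * 'X ^+ 3 = 0 -> u = 0.
  by move/eqP; rewrite mulf_eq0 expf_eq0 polyX_eq0 orbF polyC_eq0 => /eqP.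
split; apply: coef3.
- have := vanish _ (I7a C); rewrite rmorphM rmorphB !rmorphXn /= !tau_xyz => <-.
  by ring.
- have := vanish _ (I7b C); rewrite rmorphM rmorphB !rmorphXn /= !tau_xyz => <-.
  by ring.
- have := vanish _ (I7c C); rewrite rmorphM rmorphB !rmorphXn /= !tau_xyz => <-.
  by ring.
Qed.

(** In [{poly {poly C}}] the inner variable will be the parameter [t] of a curve, the outer one the
    scaling of its points. *)
Lemma polyC_linear_dvd (c : C) (G : {poly {poly C}}) :
  (exists q, G = ('X - c%:P)%:P * q) <-> map_poly (horner_eval c) G = 0.
Proof.
split=> [[q ->]|G0].
  by rewrite rmorphM /= map_polyC /= /horner_eval !hornerE subrr mul0r.
exists (\poly_(i < size G) (G`_i %/ ('X - c%:P))); apply/polyP => i.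
rewrite coefCM coef_poly; case: ltnP => [_|/leq_sizeP->]; rewrite ?mulr0 //.
rewrite mulrC divpK // dvdp_XsubCl; apply/rootP.
by have := congr1 (fun p : {poly C} => p`_i) G0; rewrite coef_map coef0.
Qed.

(* The conic [X^2 + Y^2 = Z^2] is parametrised by [(2sw, w^2 - s^2, w^2 + s^2)]
   with [s = t], [w = 1 + 2t], so that no point of interest lies at [t = oo]. The
   quartic is the image of the conic [(X / al, Y / be, Z / ga)], which passes
   through the points (+-1, +-1, 1), by the Cremona involution. *)
Local Notation w := (1 + 2 * 'X : {poly C}).
Definition conicX : {poly C} := 2 * 'X * w.
Definition conicY : {poly C} := w ^+ 2 - 'X ^+ 2.
Definition conicZ : {poly C} := w ^+ 2 + 'X ^+ 2.

Lemma conicE : conicX ^+ 2 + conicY ^+ 2 = conicZ ^+ 2.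
Proof. by rewrite /conicX /conicY /conicZ; ring. Qed.

Lemma conicX_horner c : conicX.[c] = 2 * c * (1 + 2 * c).
Proof. by rewrite /conicX !hornerE /=; ring. Qed.
Lemma conicY_horner c : conicY.[c] = (1 + 2 * c) ^+ 2 - c ^+ 2.
Proof. by rewrite /conicY !hornerE /=; ring. Qed.
Lemma conicZ_horner c : conicZ.[c] = (1 + 2 * c) ^+ 2 + c ^+ 2.
Proof. by rewrite /conicZ !hornerE /=; ring. Qed.

(** * Bezout on a rational quartic with three nodes *)

Section Quartic.
Variables (al be ga : C).
Hypothesis conic_abc : al ^+ 2 + be ^+ 2 = ga ^+ 2.
Hypotheses (al0 : al != 0) (be0 : be != 0) (ga0 : ga != 0).
Hypothesis at_oo : 25 * be ^+ 2 != 9 * ga ^+ 2.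
Local Notation X := conicX.
Local Notation Y := conicY.
Local Notation Z := conicZ.

Let phi0 := al%:P * (Y * Z).
Let phi1 := be%:P * (X * Z).
Let phi2 := ga%:P * (X * Y).
Let E := be%:P ^+ 2 * Z ^+ 2 - ga%:P ^+ 2 * Y ^+ 2.
(** The ten roots, with multiplicity, are the parameters of the seven points: [X], [Y], [Z] give the
    two branches at each node, [E] the four points [(1 : +-1 : +-1)]. *)
Let W := X * Y * Z * E.

Let theta : A -> {poly {poly C}} :=
  msubst (polyC \o polyC) (phi0%:P * 'X) (phi1%:P * 'X) (phi2%:P * 'X).

Lemma quartic_I7 g : I g -> exists q, theta g = W%:P * q.
Proof.
(* By the two conic equations, [E] also equals [ga^2 X^2 - al^2 Z^2] and [be^2 X^2 - al^2 Y^2]. *)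
have X2 : X ^+ 2 = Z ^+ 2 - Y ^+ 2 by rewrite -conicE addrK.
have al2 : al%:P ^+ 2 = ga%:P ^+ 2 - be%:P ^+ 2.
  by rewrite -!rmorphXn -rmorphB -conic_abc addrK.
apply: (@I7_rmorph _ _ theta).
- exists ((al%:P * X)%:P * 'X ^+ 3).
  by rewrite rmorphM rmorphB !rmorphXn /= /theta !msubst_xyz /phi0 /phi1 /phi2
    /W /E; ring.
- exists ((be%:P * Y)%:P * 'X ^+ 3).
  have -> : W = X * Y * Z * (ga%:P ^+ 2 * X ^+ 2 - al%:P ^+ 2 * Z ^+ 2).
    by rewrite X2 al2 /W /E; ring.
  by rewrite rmorphM rmorphB !rmorphXn /= /theta !msubst_xyz /phi0 /phi1 /phi2;
    ring.
- exists ((- ga%:P * Z)%:P * 'X ^+ 3).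
  have -> : W = X * Y * Z * (be%:P ^+ 2 * X ^+ 2 - al%:P ^+ 2 * Y ^+ 2).
    by rewrite X2 al2 /W /E; ring.
  by rewrite rmorphM rmorphB !rmorphXn /= /theta !msubst_xyz /phi0 /phi1 /phi2;
    ring.
Qed.

Lemma theta_horner c g :
  map_poly (horner_eval c) (theta g) = tau phi0.[c] phi1.[c] phi2.[c] g.
Proof. exact: horner_msubst. Qed.

Lemma size_W : (10 < size W)%N.
Proof.
have coef_size (p : {poly C}) k : p`_k != 0 -> (k < size p)%N.
  by rewrite ltnNge; apply: contra => /leq_sizeP->.
have sX : (2 < size X)%N.
  apply: coef_size; rewrite (_ : X = 4%:P * 'X^2 + 2%:P * 'X).
    by rewrite !coefD !coefCM !coefXn coefX /= mulr1 mulr0 addr0 pnatr_eq0.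
  by rewrite /X; ring.
have sY : (2 < size Y)%N.
  apply: coef_size; rewrite (_ : Y = 3%:P * 'X^2 + 4%:P * 'X + 1%:P).
    by rewrite !coefD !coefCM !coefXn coefX coefC /= mulr1 mulr0 !addr0 pnatr_eq0.
  by rewrite /Y; ring.
have sZ : (2 < size Z)%N.
  apply: coef_size; rewrite (_ : Z = 5%:P * 'X^2 + 4%:P * 'X + 1%:P).
    by rewrite !coefD !coefCM !coefXn coefX coefC /= mulr1 mulr0 !addr0 pnatr_eq0.
  by rewrite /Z; ring.
(* The leading coefficient is nonzero by [at_oo]: no root of [E] has moved to [t = oo]. *)
have sE : (4 < size E)%N.
  apply: coef_size; rewrite (_ : E =
      (25 * be ^+ 2 - 9 * ga ^+ 2)%:P * 'X^4 +
      (40 * be ^+ 2 - 24 * ga ^+ 2)%:P * 'X^3 +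
      (26 * be ^+ 2 - 22 * ga ^+ 2)%:P * 'X^2 +
      (8 * be ^+ 2 - 8 * ga ^+ 2)%:P * 'X + (be ^+ 2 - ga ^+ 2)%:P).
    rewrite !coefD !coefCM !coefXn coefX coefC /= mulr1 !mulr0 !addr0.
    by rewrite subr_eq0.
  by rewrite /E /Z /Y; ring.
have size_ge (p q : {poly C}) k j :
    (k < size p)%N -> (j < size q)%N -> (k + j < size (p * q)%R)%N.
  move=> kp jq; have p0 : p != 0 by rewrite -size_poly_gt0 (leq_trans _ kp).
  have q0 : q != 0 by rewrite -size_poly_gt0 (leq_trans _ jq).
  by rewrite size_mul // ltn_predRL -addSn -addnS leq_add.
exact: (@size_ge _ _ 6 4 (@size_ge _ _ 4 2 (@size_ge _ _ 2 2 sX sY) sZ) sE).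
Qed.

(** If all three products vanish, so do two of [X], [Y], [Z], hence the third by the conic equation;
    but [Y = Z = 0] forces [w = t = 0], while [w = 1] at [t = 0]. *)
Lemma quartic_neq0 c : [|| phi0.[c] != 0, phi1.[c] != 0 | phi2.[c] != 0].
Proof.
apply/negPn/negP; rewrite !negb_or !negbK /phi0 /phi1 /phi2 !hornerCM.
rewrite (hornerM Y Z) (hornerM X Z) (hornerM X Y).
have XYZ : X.[c] ^+ 2 + Y.[c] ^+ 2 = Z.[c] ^+ 2.
  by rewrite -!horner_exp -hornerD conicE.
have two0 : 2 != 0 :> C by rewrite pnatr_eq0.
have key (u v : C) : u ^+ 2 - v ^+ 2 = 0 -> u ^+ 2 + v ^+ 2 = 0 -> v = 0 /\ u = 0.
  move=> uv uv'; have v0 : v = 0.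
    have E2 : 2 * v ^+ 2 = (u ^+ 2 + v ^+ 2) - (u ^+ 2 - v ^+ 2) by ring.
    apply/eqP; rewrite -sqrf_eq0 -[_ == 0]/(false || _) -(negPf two0) -mulf_eq0.
    by rewrite E2 uv uv' subrr.
  by split=> //; apply/eqP; rewrite -sqrf_eq0 -uv' v0 expr0n addr0.
have YZ : Y.[c] = 0 -> Z.[c] = 0 -> False.
  rewrite /Y /Z hornerD hornerN hornerD !horner_exp hornerX => Yc Zc.
  have [c0] := key _ _ Yc Zc.
  by rewrite c0 !hornerE => /eqP; rewrite oner_eq0.
have sq0 (u : C) : u ^+ 2 = 0 -> u = 0.
  by move=> u0; apply/eqP; rewrite -sqrf_eq0 u0.
move: X.[c] Y.[c] Z.[c] XYZ YZ => u v t uvt vt.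
rewrite !mulf_eq0 (negPf al0) (negPf be0) (negPf ga0) /=.
case/and3P=> /orP[] /eqP e1 /orP[] /eqP e2 /orP[] /eqP e3; apply: vt => //;
  apply: sq0; move: uvt; rewrite ?e1 ?e2 ?e3 expr0n ?addr0 ?add0r //.
Qed.

Lemma quartic_base c : root W c -> base_point phi0.[c] phi1.[c] phi2.[c].
Proof.
move=> /rootP Wc.
have vanish g : I g -> (tau phi0.[c] phi1.[c] phi2.[c] g) = 0.
  move=> /quartic_I7[q thE]; rewrite -theta_horner thE rmorphM /= map_polyC /=.
  by rewrite /horner_eval Wc mul0r.
exact: tau_base_point.
Qed.

Lemma quartic_symbolic m f :
  symbolic_pow I m f -> exists q, theta f = (W ^+ m)%:P * q.
Proof.
move=> fS.
have W0 : W != 0 by rewrite -size_poly_gt0 (leq_trans _ size_W).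
have [r rE] := closed_field_poly_normal (W ^+ m).
have lead0 : lead_coef (W ^+ m) != 0 by rewrite lead_coef_eq0 expf_neq0.
have PE : (W ^+ m)%:P = (lead_coef (W ^+ m))%:P%:P *
    \prod_(d <- [seq ('X - c%:P)%:P | c <- r]) d.
  by rewrite {1}rE -mul_polyC polyCM rmorph_prod big_map.
have unit_lead : (lead_coef (W ^+ m))%:P%:P * (lead_coef (W ^+ m))^-1%:P%:P = 1.
  by rewrite -!polyCM mulfV.
suff [q qE] : exists q, theta f = (\prod_(d <- [seq ('X - c%:P)%:P | c <- r]) d) * q.
  exists ((lead_coef (W ^+ m))^-1%:P%:P * q).
  by rewrite PE mulrACA unit_lead mul1r.
(* The linear factors [t - c] of [W^m] are primes, listed with repetition. At the point of parameter
   [c] some [s] outside its prime has [s f] in [I^m]: then [W^m] divides [theta s * theta f], but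
   [t - c] does not divide [theta s]. *)
apply: prod_primes_dvd => _ /mapP[c rc ->].
have Wc : root W c.
  have : root (W ^+ m) c by rewrite rE rootZ // root_prod_XsubC.
  by rewrite /root horner_exp expf_eq0 => /andP[].
split; first by rewrite polyC_eq0 polyXsubC_eq0.
  move=> g h /polyC_linear_dvd/eqP; rewrite rmorphM mulf_eq0.
  by case/orP=> /eqP ?; [left|right]; apply/polyC_linear_dvd.
have [u [L sep]] := base_point_separates (quartic_base Wc) (quartic_neq0 c).
have [s [s_n0 sf]] := symbolic_separated (quartic_base Wc) sep fS.
exists (theta s); split.
  by move/polyC_linear_dvd; rewrite theta_horner; apply/eqP.
have [q qE] := ideal_pow_rmorph quartic_I7 sf.
exists ((lead_coef (W ^+ m))%:P%:P * q).
by rewrite mulrA [_ * _%:P]mulrC -PE rmorphXn -qE rmorphM.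
Qed.

Lemma size_theta f d : (size ((theta f)`_d)%R <= 4 * d + 1)%N.
Proof.
have pred_le i j k l e : (i <= k -> j <= l -> k + l <= e.+1 -> (i + j).-1 <= e)%N.
  by lia.
have sX : (size X <= 3)%N.
  rewrite (_ : X = 4 *: 'X^2 + 2 *: 'X); last by rewrite /X -!mul_polyC; ring.
  rewrite (leq_trans (size_polyD _ _)) // geq_max.
  by rewrite !(leq_trans (size_scale_leq _ _)) ?size_polyXn ?size_polyX.
have sw : (size w%R <= 2)%N.
  rewrite (leq_trans (size_polyD _ _)) // geq_max size_poly1 /=.
  rewrite -(rmorph_nat polyC) mul_polyC.
  by rewrite (leq_trans (size_scale_leq _ _)) ?size_polyX.
have sqr (p : {poly C}) : (size p <= 2)%N -> (size (p ^+ 2)%R <= 3)%N.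
  by move=> sp; rewrite (leq_trans (size_exp_leq _ _)) //; lia.
have sX' : (size ('X : {poly C})%R <= 2)%N by rewrite size_polyX.
have sY : (size Y <= 3)%N.
  by rewrite (leq_trans (size_polyD _ _)) // geq_max size_polyN !sqr.
have sZ : (size Z <= 3)%N by rewrite (leq_trans (size_polyD _ _)) // geq_max !sqr.
have sM (u : C) (p q : {poly C}) : (size p <= 3)%N -> (size q <= 3)%N ->
    (size (u%:P * (p * q))%R <= 5)%N.
  move=> sp sq; rewrite mul_polyC (leq_trans (size_scale_leq _ _)) //.
  exact/(leq_trans (size_polyMleq _ _))/(pred_le _ _ _ _ _ sp sq).
pose N j : set {poly C} := [set p | (size p <= 4 * j + 1)%N].
suff : N d (theta f)`_d by [].
apply: (msubst_filtration (N := N)) => [j|j p q|u|i j p q|j|j|j]; rewrite /N /=.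
- by rewrite size_poly0.
- by move=> sp sq; rewrite (leq_trans (size_polyD _ _)) // geq_max sp sq.
- by rewrite size_polyC; case: eqP.
- move=> sp sq; apply/(leq_trans (size_polyMleq _ _)).
  by apply/(pred_le _ _ _ _ _ sp sq); lia.
- by rewrite coef_CX; case: eqP => [->|_]; rewrite ?size_poly0 ?sM.
- by rewrite coef_CX; case: eqP => [->|_]; rewrite ?size_poly0 ?sM.
- by rewrite coef_CX; case: eqP => [->|_]; rewrite ?size_poly0 ?sM.
Qed.

(** On the quartic the component has degree at most [4 d] in [t], yet it is divisible by [W^m], of
    degree at least [10 m]. *)
Lemma quartic_vanishing m f d c : symbolic_pow I m f -> (2 * d < 5 * m)%N ->
  (tau phi0.[c] phi1.[c] phi2.[c] f)`_d = 0.
Proof.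
move=> /quartic_symbolic[q thE] lt_dm; rewrite -theta_horner coef_map /=.
suff -> : (theta f)`_d = 0 by rewrite /horner_eval horner0.
have W0 : W != 0 by rewrite -size_poly_gt0 (leq_trans _ size_W).
have := size_theta f d; rewrite thE coefCM.
have [->|q0] := eqVneq q`_d 0; first by rewrite mulr0.
have arith k j l : (j.-1 = k.-1 * m -> 10 < k -> 0 < j -> 0 < l ->
    (j + l).-1 <= 4 * d + 1 -> False)%N.
  move=> jE k_gt; have : (10 * m <= k.-1 * m)%N by rewrite leq_mul // -ltnS; lia.
  by lia.
rewrite size_mul ?expf_neq0 // => size_le; exfalso.
by apply: (arith _ _ _ (size_exp W m) size_W _ _ size_le);
  rewrite size_poly_gt0 ?expf_neq0.
Qed.

End Quartic.

Lemma tau_scale k p q r f d :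
  (tau (k * p) (k * q) (k * r) f)`_d = k ^+ d * (tau p q r f)`_d.
Proof.
rewrite -!ev_Phi.
pose N j : set A := [set g | ev (k * p) (k * q) (k * r) g = k ^+ j * ev p q r g].
suff : N d (Phi f)`_d by [].
apply: (@Phi_filtration C N); rewrite /N /=.
- by move=> j; rewrite !rmorph0 mulr0.
- by move=> j g h gE hE; rewrite !rmorphD /= gE hE mulrDr.
- by move=> c; rewrite !evC mul1r.
- by move=> i j g h gE hE; rewrite !rmorphM /= gE hE exprD mulrACA.
- by rewrite !ev_xyz.
- by rewrite !ev_xyz.
- by rewrite !ev_xyz.
Qed.

(* The quartic of the pencil through a general point. *)
Lemma symbolic_ev p q r m f d :
  p != 0 -> q != 0 -> r != 0 ->
  r ^+ 2 != q ^+ 2 -> p ^+ 2 != r ^+ 2 -> p ^+ 2 != q ^+ 2 ->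
  9 * (r ^+ 2 - q ^+ 2) != 16 * (p ^+ 2 - r ^+ 2) ->
  25 * (q ^+ 2 * (p ^+ 2 - r ^+ 2)) != 9 * (r ^+ 2 * (p ^+ 2 - q ^+ 2)) ->
  symbolic_pow I m f -> (2 * d < 5 * m)%N -> (tau p q r f)`_d = 0.
Proof.
(* With [al = p u], [be = q v], [ga = r t], the point [(u : v : t)] of the standard conic is sent to
   [(p : q : r)]. *)
move=> p0 q0 r0 rq pr pq not_oo be_ga fS lt_dm.
set u := sqrtC (r ^+ 2 - q ^+ 2); set v := sqrtC (p ^+ 2 - r ^+ 2).
set t := sqrtC (p ^+ 2 - q ^+ 2).
have uE : u ^+ 2 = r ^+ 2 - q ^+ 2 by rewrite sqrtCK.
have vE : v ^+ 2 = p ^+ 2 - r ^+ 2 by rewrite sqrtCK.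
have tE : t ^+ 2 = p ^+ 2 - q ^+ 2 by rewrite sqrtCK.
have u0 : u != 0 by rewrite -sqrf_eq0 uE subr_eq0.
have v0 : v != 0 by rewrite -sqrf_eq0 vE subr_eq0.
have t0 : t != 0 by rewrite -sqrf_eq0 tE subr_eq0.
have uvt : u ^+ 2 = t ^+ 2 - v ^+ 2 by rewrite uE vE tE; ring.
have vt0 : v + t != 0.
  apply: contraNneq u0 => vt0; rewrite -sqrf_eq0 uvt subr_sqr.
  by rewrite [t + v]addrC vt0 mulr0.
(* The point [(u : v : t)] has [s : w = u : (v + t)]; with [w = 1 + 2 s] this gives [s = u / T]. *)
set T := v + t - 2 * u.
have T0 : T != 0.
  apply: contra_neq not_oo => T0.
  have tE' : t = 2 * u - v by rewrite -[RHS]add0r -T0 /T; ring.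
  have E : u * (3 * u - 4 * v) = 0.
    have -> : u * (3 * u - 4 * v) = t ^+ 2 - v ^+ 2 - u ^+ 2 by rewrite tE'; ring.
    by rewrite uvt subrr.
  have {E} : 3 * u = 4 * v.
    by move/eqP: E; rewrite mulf_eq0 (negPf u0) subr_eq0 => /eqP.
  move/(congr1 (fun e : C => e ^+ 2)); rewrite !exprMn uE vE -!natrX.
  exact.
have conic : (p * u) ^+ 2 + (q * v) ^+ 2 = (r * t) ^+ 2.
  by rewrite !exprMn uE vE tE; ring.
have oo : 25 * (q * v) ^+ 2 != 9 * (r * t) ^+ 2 by rewrite !exprMn vE tE.
have := @quartic_vanishing (p * u) (q * v) (r * t) conic
  (mulf_neq0 p0 u0) (mulf_neq0 q0 v0) (mulf_neq0 r0 t0) oo m f d (u / T) fS lt_dm.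
have wE : 1 + 2 * (u / T) = (v + t) / T.
  have -> : v + t = T + 2 * u by rewrite /T subrK.
  by rewrite [RHS]mulrDl divff // mulrA.
pose k := 2 * (v + t) / T ^+ 2.
have Xc : conicX.[u / T] = k * u.
  by rewrite conicX_horner wE /k expr2 invfM; ring.
have Yc : conicY.[u / T] = k * v.
  rewrite conicY_horner wE !expr_div_n -mulrBl uvt /k mulrAC.
  by congr (_ / _); ring.
have Zc : conicZ.[u / T] = k * t.
  rewrite conicZ_horner wE !expr_div_n -mulrDl uvt /k mulrAC.
  by congr (_ / _); ring.
rewrite !hornerCM !(hornerM conicX) !(hornerM conicY) Xc Yc Zc.
pose K := k ^+ 2 * u * v * t.
have -> : p * u * (k * v * (k * t)) = K * p by rewrite /K; ring.
have -> : q * v * (k * u * (k * t)) = K * q by rewrite /K; ring.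
have -> : r * t * (k * u * (k * v)) = K * r by rewrite /K; ring.
rewrite tau_scale => /eqP; rewrite mulf_eq0 expf_eq0 => /orP[|/eqP//].
rewrite /K /k !mulf_eq0 invr_eq0 !expf_eq0 (negPf u0) (negPf v0) (negPf t0).
by rewrite (negPf T0) (negPf vt0) pnatr_eq0 !andbF.
Qed.

(** The genericity conditions of [symbolic_ev] say that a nonzero polynomial [D] does not vanish, so
    the component times [D] vanishes at all points. *)
Theorem symbolic_initial_degree m f d :
  symbolic_pow I m f -> (2 * d < 5 * m)%N -> (Phi f)`_d = 0.
Proof.
move=> fS lt_dm.
pose D : A := x * y * z * (z ^+ 2 - y ^+ 2) * (x ^+ 2 - z ^+ 2) *
  (x ^+ 2 - y ^+ 2) * (9 * (z ^+ 2 - y ^+ 2) - 16 * (x ^+ 2 - z ^+ 2)) *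
  (25 * (y ^+ 2 * (x ^+ 2 - z ^+ 2)) - 9 * (z ^+ 2 * (x ^+ 2 - y ^+ 2))).
have evD p q r : ev p q r D =
  p * q * r * (r ^+ 2 - q ^+ 2) * (p ^+ 2 - r ^+ 2) *
  (p ^+ 2 - q ^+ 2) * (9 * (r ^+ 2 - q ^+ 2) - 16 * (p ^+ 2 - r ^+ 2)) *
  (25 * (q ^+ 2 * (p ^+ 2 - r ^+ 2)) - 9 * (r ^+ 2 * (p ^+ 2 - q ^+ 2))).
  by rewrite /D !(rmorphM, rmorphB, rmorphXn, rmorph_nat) /= !ev_xyz.
have D0 : D != 0.
  have : ev 1 2 3 D = 1 * 2 * 3 * 5 * 8 * 3 * 173 * (- 557).
    by rewrite evD; ring.
  apply: contra_eq_neq => ->; rewrite rmorph0 eq_sym.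
  by rewrite !mulf_neq0 ?oppr_eq0 ?pnatr_eq0 ?oner_eq0.
have /eqP : (Phi f)`_d * D = 0.
  apply: mpoly_vanishing => p q r; rewrite rmorphM /= ev_Phi.
  have [->|] := eqVneq (ev p q r D) 0; first by rewrite mulr0.
  rewrite evD !mulf_eq0 !negb_or !subr_eq0 -!andbA.
  case/and5P=> p0 q0 r0 rq /and4P[pr pq not_oo be_ga].
  by rewrite (@symbolic_ev _ _ _ m) ?mul0r.
by rewrite mulf_eq0 (negPf D0) orbF => /eqP.
Qed.

End InitialDegree.

(** * Containments and non-containments *)

Section Containment.
Variable C : numClosedFieldType.
Local Notation A := (mpoly 3 C).
Local Notation cst := (@mpolyC 3 C).
Local Notation x := (mvar C 0).
Local Notation y := (mvar C 1).
Local Notation z := (mvar C 2).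
Local Notation I := (@I7 C).
Local Notation l := (x + y + z).
Implicit Types (f g : A) (p : set A).

Lemma symbolic_containment m r : (6 * r < 5 * m)%N ->
  symbolic_pow I m `<=` ideal_pow I r.
Proof.
move=> lt_rm f fS; have [N] := symbolic_saturation fS.
have le_rm : (r <= m)%N by lia.
(* In degrees [d <= 3 r] one has [2 d <= 6 r < 5 m]. A factor [l] then raises the order to the
   [3 r + 2] required for saturation. *)
have f_o : order_ge (3 * r + 1)%N f.
  by move=> d lt_d; apply: (symbolic_initial_degree fS); lia.
move=> /(ideal_pow_anti le_rm).
elim: N => [|N IHN]; first by rewrite expr0 mul1r.
rewrite exprS -mulrA => lP; apply/IHN/(ideal_pow_saturated lP); right.
have l1 : order_ge 1 l by apply/order_ge_form/is_form_l.
apply: order_ge_le (order_geM l1 (is_idealMl _ (order_ge_ideal C _) f_o)).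
by lia.
Qed.

(** [I] is saturated: if [l f] lies in [I], so does [f], and its annihilator would be the whole
    ring. *)
Lemma associated_prime_l p : associated_prime I p -> ~ p l.
Proof.
move=> [/prime_idealP[_ p1 _] [f pE]]; rewrite pE /= => lf; apply: p1.
rewrite pE /= mul1r; apply: (ideal_pow1 (I7_ideal C)).
by apply: ideal_pow_saturated; [exact: mem_ideal_pow1 | left].
Qed.

(* [P ^ 2 Q], where [P] is the product of the six lines through three of the
   seven points and [Q = x y z]. *)
Definition line_form : A :=
  ((y ^+ 2 - z ^+ 2) * (z ^+ 2 - x ^+ 2) * (x ^+ 2 - y ^+ 2)) ^+ 2 * (x * y * z).

Lemma line_form_away_axes : ideal_pow I 6 (x * y * z * line_form).
Proof.
rewrite (_ : _ * line_form = (x * (y ^+ 2 - z ^+ 2) * (y * (z ^+ 2 - x ^+ 2)) *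
  (z * (x ^+ 2 - y ^+ 2))) ^+ 2); last by rewrite /line_form; ring.
exact: (ideal_powX 2 (ideal_powM (ideal_powM (mem_ideal_pow1 (I7a C))
  (mem_ideal_pow1 (I7b C))) (mem_ideal_pow1 (I7c C)))).
Qed.

(** Where [u] and [v] are invertible, [Y] and [Z] lie in the ideal, so [Y^2 - Z^2] lies in its
    square and [(Y^2 - Z^2)^2 Y Z] in its sixth power; the multiplier clears the denominators. *)
Lemma line_form_near_axis (X Y Z : A) :
  I (Y * (Z ^+ 2 - X ^+ 2)) -> I (Z * (X ^+ 2 - Y ^+ 2)) ->
  ideal_pow I 6 (((Z ^+ 2 - X ^+ 2) * (X ^+ 2 - Y ^+ 2)) ^+ 5 *
    (((Y ^+ 2 - Z ^+ 2) * (Z ^+ 2 - X ^+ 2) * (X ^+ 2 - Y ^+ 2)) ^+ 2 * (X * Y * Z))).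
Proof.
move=> /mem_ideal_pow1 Ib /mem_ideal_pow1 Ic.
set u := Z ^+ 2 - X ^+ 2 in Ib *; set v := X ^+ 2 - Y ^+ 2 in Ic *.
have idP := ideal_pow_ideal I 2.
have sq : ideal_pow I 2 ((Y * u) ^+ 2 * v ^+ 2 - (Z * v) ^+ 2 * u ^+ 2).
  by apply: is_idealB => //; apply: is_idealMr => //;
    [exact: (ideal_powX 2 Ib) | exact: (ideal_powX 2 Ic)].
have := ideal_powM (ideal_powX 2 sq) (ideal_powM Ib Ic).
move=> /(is_idealMl (X * u ^+ 2 * v ^+ 2) (ideal_pow_ideal I 6)).
by congr (ideal_pow I 6 _); ring.
Qed.

Lemma line_form_symbolic : symbolic_pow I 6 line_form.
Proof.
apply/symbolic_powP => p assp; have pl := associated_prime_l assp.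
have [/prime_idealP[idp p1 pM] [g pE]] := assp.
have Ip f : I f -> p f.
  by move=> If; rewrite pE /=; apply: is_idealMr (I7_ideal C) If.
have pX k f : p (f ^+ k) -> p f.
  by elim: k => [|k IHk]; rewrite ?expr0 // exprS => /pM[].
(* A prime containing [Y], [Z] and the multiplier contains [X], hence [l]. *)
have near_axis (X Y Z : A) : p Y -> p Z -> X + Y + Z = l ->
    ~ p (((Z ^+ 2 - X ^+ 2) * (X ^+ 2 - Y ^+ 2)) ^+ 5).
  move=> pY pZ lE pXYZ; apply: pl; rewrite -lE.
  apply: (is_idealD idp) => //; apply: (is_idealD idp) => //.
  apply: (pX 2); have [Z2|Y2] := pM _ _ (pX _ _ pXYZ).
  - have -> : X ^+ 2 = Z * Z - (Z ^+ 2 - X ^+ 2) by ring.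
    by apply: is_idealB => //; apply: is_idealMl.
  - have -> : X ^+ 2 = (X ^+ 2 - Y ^+ 2) + Y * Y by ring.
    by apply: is_idealD => //; apply: is_idealMl.
have axis (X Y Z : A) : p X -> p (Y * (Z ^+ 2 - X ^+ 2)) -> p Y \/ p Z.
  move=> pX' /pM[pY|pZ]; [by left|right; apply: (pX 2)].
  have -> : Z ^+ 2 = (Z ^+ 2 - X ^+ 2) + X * X by ring.
  by apply: is_idealD => //; apply: is_idealMl.
have axis_x : p y -> p z -> exists s, ~ p s /\ ideal_pow I 6 (s * line_form).
  move=> py pz; have := near_axis x y z py pz erefl.
  move=> ns; eexists; split; first exact: ns.
  exact: line_form_near_axis (I7b C) (I7c C).
have axis_y : p z -> p x -> exists s, ~ p s /\ ideal_pow I 6 (s * line_form).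
  move=> pz px; have lE : y + z + x = l by ring.
  have ns := near_axis y z x pz px lE; eexists; split; first exact: ns.
  rewrite (_ : line_form = ((z ^+ 2 - x ^+ 2) * (x ^+ 2 - y ^+ 2) *
    (y ^+ 2 - z ^+ 2)) ^+ 2 * (y * z * x)); last by rewrite /line_form; ring.
  exact: line_form_near_axis (I7c C) (I7a C).
have axis_z : p x -> p y -> exists s, ~ p s /\ ideal_pow I 6 (s * line_form).
  move=> px py; have lE : z + x + y = l by ring.
  have ns := near_axis z x y px py lE; eexists; split; first exact: ns.
  rewrite (_ : line_form = ((x ^+ 2 - y ^+ 2) * (y ^+ 2 - z ^+ 2) *
    (z ^+ 2 - x ^+ 2)) ^+ 2 * (z * x * y)); last by rewrite /line_form; ring.
  exact: line_form_near_axis (I7a C) (I7b C).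
(* Outside [p], [x y z] itself is the multiplier; otherwise [p] contains one variable and therefore
   a second. *)
have [pxyz|pxyz] := pselect (p (x * y * z)); last first.
  by exists (x * y * z); split=> //; apply: line_form_away_axes.
have [/pM[px|py]|pz] := pM _ _ pxyz.
- by have [py|pz] := axis _ _ _ px (Ip _ (I7b C)); [exact: axis_z | exact: axis_y].
- by have [pz|px] := axis _ _ _ py (Ip _ (I7c C)); [exact: axis_x | exact: axis_z].
- by have [px|py] := axis _ _ _ pz (Ip _ (I7a C)); [exact: axis_y | exact: axis_x].
Qed.

Lemma homog_mvar k : mvar C k \is ishomog1 1 mdeg.
Proof. by rewrite dhomogX; apply/eqP/mdeg1. Qed.

Lemma homog_line_form k : line_form ^+ k \is ishomog1 (15 * k) mdeg.
Proof.
have sq i j : mvar C i ^+ 2 - mvar C j ^+ 2 \is ishomog1 2 mdeg.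
  by apply: rpredB; exact: (dhomogMn 2 (homog_mvar _)).
have P6 := dhomogM (dhomogM (sq 1%N 2%N) (sq 2%N 0%N)) (sq 0%N 1%N).
have Q3 := dhomogM (dhomogM (homog_mvar 0) (homog_mvar 1)) (homog_mvar 2).
exact: (dhomogMn k (dhomogM (dhomogMn 2 P6) Q3)).
Qed.

Lemma homog_is_form d f : f \is ishomog1 d mdeg -> is_form d f.
Proof.
move=> /dhomogP fd; rewrite [f]mpolyE big_seq.
elim/big_ind: _ => [|g h|m /fd mE].
- by rewrite /is_form rmorph0 polyC0 mul0r.
- exact: is_formD.
rewrite -mul_mpolyC -[d]add0n; apply: is_formM.
  by rewrite /is_form PhiC expr0 mulr1.
have {mE} <- : mdeg m = d by [].
rewrite mpolyXE_id mdegE; elim/big_ind2: _ => [|i g j h gi hj|i _].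
- by rewrite /is_form rmorph1 expr0 mulr1.
- exact: is_formM.
suff vi : is_form 1 (mpolyX C (mnm1 i)).
  by have := is_formX (m i) vi; rewrite mul1n.
by have [->|->|->] := ord3_cases i;
  [exact: is_form_x | exact: is_form_y | exact: is_form_z].
Qed.

Lemma line_form_neq0 : line_form != 0.
Proof.
have : ev 1 2 3 line_form = (5 * 8 * 3) ^+ 2 * (1 * 2 * 3).
  by rewrite !(rmorphM, rmorphB, rmorphXn) /= !ev_xyz; ring.
apply: contra_eq_neq => ->; rewrite rmorph0 eq_sym.
by rewrite !mulf_neq0 ?expf_neq0 ?mulf_neq0 ?pnatr_eq0 ?oner_eq0.
Qed.

Lemma ideal_pow_order r f : ideal_pow I r f -> order_ge (3 * r)%N f.
Proof.
move: f; apply: ideal_pow_min; first exact: order_ge_ideal.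
have I3 : I `<=` order_ge 3.
  apply: I7_min; first exact: order_ge_ideal.
  - exact/order_ge_form/(is_form_cubic (is_form_x C) (is_form_y C) (is_form_z C)).
  - exact/order_ge_form/(is_form_cubic (is_form_y C) (is_form_z C) (is_form_x C)).
  - exact/order_ge_form/(is_form_cubic (is_form_z C) (is_form_x C) (is_form_y C)).
elim: r => [|r IHr] s Is; first exact: (@order_ge0 C).
rewrite big_ord_recl mulnS; apply: order_geM; first exact/I3/Is.
by apply: IHr => i; apply: Is.
Qed.

Lemma symbolic_noncontainment k r : (5 * k < r)%N ->
  ~ (symbolic_pow I (6 * k)%N `<=` ideal_pow I r).
Proof.
move=> lt_kr sub.
have /ideal_pow_order/(_ (15 * k)%N) := sub _ (symbolic_powX k line_form_symbolic).
rewrite (coef_Phi_form _ (homog_is_form (homog_line_form k))) eqxx => F0.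
have : line_form ^+ k != 0 by rewrite expf_neq0 ?line_form_neq0.
by rewrite F0 ?eqxx //; lia.
Qed.

Lemma alpha_symbolic_bounds m : (0 < m)%N ->
  (5 * m <= 2 * alpha (symbolic_pow I m) <= 5 * m + 30)%N.
Proof.
move=> m_gt0; set J := symbolic_pow I m.
(* [6 k] is the least multiple of 6 greater than [m]. *)
pose k := (m %/ 6).+1.
have form_k : has_form_of_degree J (15 * k)%N.
  exists (line_form ^+ k); split; last exact: homog_line_form.
  - apply: (symbolic_pow_anti _ (symbolic_powX k line_form_symbolic)).
    by rewrite /k; lia.
  - by rewrite expf_neq0 ?line_form_neq0.
(* A form exists, so [alpha] does not take its default value. *)
have [aF a_min] : has_form_of_degree J (alpha J) /\
    forall e, has_form_of_degree J e -> (alpha J <= e)%N.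
  apply: (@xgetPex _ 0%N [set d | has_form_of_degree J d /\
    forall e, has_form_of_degree J e -> (d <= e)%N]).
  have ex_d : exists d, `[< has_form_of_degree J d >].
    by exists (15 * k)%N; apply/asboolP.
  case: (ex_minnP ex_d) => d /asboolP Jd d_min; exists d; split=> // e Je.
  exact/d_min/asboolP.
apply/andP; split; last by have := a_min _ form_k; rewrite /k; lia.
have [f [Jf f0 /homog_is_form fa]] := aF.
rewrite leqNgt; apply/negP => /(symbolic_initial_degree Jf).
by rewrite (coef_Phi_form _ fa) eqxx; apply/eqP.
Qed.

End Containment.

(** * The three constants *)

Lemma I2E (R : realType) : I2 R = @I7 R[i].
Proof. by []. Qed.

Lemma ereal_ge_limit (R : realType) (s : \bar R) :
  (forall k, (0 < k)%N -> ((6 * k)%:R / (5 * k + 1)%:R)%:E <= s)%E ->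
  ((6 / 5 : R)%:E <= s)%E.
Proof.
case: s => [s| |] s_ge; last 2 first.
- by rewrite leey.
- by have := s_ge 1%N isT; rewrite leeNy_eq.
rewrite lee_fin leNgt; apply/negP => s_lt.
(* If [k e > |s|], then [6 k > s (5 k + 1)], against the hypothesis. *)
pose e := 6 - 5 * s.
have e0 : 0 < e by rewrite /e; lra.
have [k k_gt] : exists k : nat, `|s| / e < k%:R.
  by exists (Num.bound (`|s| / e)); apply: archi_boundP; rewrite divr_ge0 // ltW.
have k0 : (0 < k)%N.
  rewrite -(ltr_nat R); apply: le_lt_trans k_gt.
  by rewrite divr_ge0 // ltW.
have := s_ge k k0; rewrite lee_fin ler_pdivrMr ?ltr0n ?addn_gt0 ?orbT //.
rewrite ltr_pdivrMr // in k_gt.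
rewrite natrD !natrM; have := ler_norm s; move: k_gt; rewrite /e; nra.
Qed.

Theorem theorem1p2 (R : realType) :
  [/\ is_waldschmidt_constant (I2 R) (5 / 2 : R),
      resurgence R (I2 R) = (6 / 5)%:E
    & asymptotic_resurgence R (I2 R) = (6 / 5)%:E].
Proof.
rewrite I2E.
have ratio_le m r : (0 < r)%N ->
    ~ (symbolic_pow (@I7 R[i]) m `<=` ideal_pow (@I7 R[i]) r)%classic ->
    ((m%:R / r%:R)%:E <= (6 / 5 : R)%:E)%E.
  move=> r0 nsub; have : (5 * m <= 6 * r)%N.
    by rewrite leqNgt; apply/negP => /symbolic_containment.
  rewrite -(ler_nat R) !natrM lee_fin ler_pdivrMr ?ltr0n // => le_mr.
  by lra.
split.
- apply/cvgrPdist_le => e e0.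
  near=> m.
  have m0 : (0 < m)%N by near: m; exact: nbhs_infty_gt.
  have /andP[] := alpha_symbolic_bounds R[i] m0.
  rewrite -!(ler_nat R) natrD !natrM => lo hi.
  have mR : 0 < m%:R :> R by rewrite ltr0n.
  (* By the bounds on [alpha], the quotient exceeds [5 / 2] by at most [15 / m]. *)
  have me : 15 / e <= m%:R by near: m; exact: nbhs_infty_ger.
  rewrite ler_pdivrMr // in me.
  set t : R := (alpha _)%:R / _.
  have tE : t * m%:R = (alpha (symbolic_pow (@I7 R[i]) m))%:R.
    by rewrite /t mulfVK // gt_eqF.
  rewrite -tE in lo hi; rewrite ler_norml; apply/andP; split; nra.
- apply/eqP; rewrite eq_le; apply/andP; split.
    by apply: ge_ereal_sup => _ [m [r [_ r0 nsub ->]]]; apply: ratio_le.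
  apply: ereal_ge_limit => k k0; apply: ereal_sup_ubound.
  exists (6 * k)%N, (5 * k + 1)%N; split; rewrite ?muln_gt0 ?addn1 //.
  exact: symbolic_noncontainment.
- apply/eqP; rewrite eq_le; apply/andP; split.
    apply: ge_ereal_sup => _ [m [r [_ r0 nsub ->]]].
    (* A single [t > 0] suffices, as [m t / (r t) = m / r]. *)
    have [t [{}nsub t0]] := filter_ex (filterI nsub (nbhs_infty_gt 0)).
    have := ratio_le (m * t)%N (r * t)%N _ nsub.
    rewrite muln_gt0 r0 t0 !natrM -mulf_div divff ?mulr1 ?pnatr_eq0 -?lt0n //.
    exact.
  apply: ereal_ge_limit => k k0; apply: ereal_sup_ubound.
  exists (6 * k)%N, (5 * k + 1)%N; split; rewrite ?muln_gt0 ?addn1 //.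
  exists 1%N => // t /= t0; rewrite -mulnA; apply: symbolic_noncontainment.
  by nia.
Unshelve. all: by end_near.
Qed.
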